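(* Let $\mathcal{A}$ and $\mathcal{B}$ be bicategories. Then $\mathcal{A}$ and $\mathcal{B}$ are biequivalent if and only if there exist a bicategory $\mathcal{C}$ and strict functors $P\colon\mathcal{C}\to\mathcal{A}$, $Q\colon\mathcal{C}\to\mathcal{B}$ each of which is a surjective equivalence.
   Context: Bicategories $\mathcal{A},\mathcal{B}$ are biequivalent if there exist pseudofunctors $F\colon\mathcal{A}\to\mathcal{B}$, $G\colon\mathcal{B}\to\mathcal{A}$ with $GF\cong 1_{\mathcal{A}}$ in the functor bicategory $[\mathcal{A},\mathcal{A}]$ (pseudofunctors, pseudonatural transformations, modifications) and $FG\cong 1_{\mathcal{B}}$ in $[\mathcal{B},\mathcal{B}]$. A strict functor (strict 2-functor) is a pseudofunctor preserving composition and identities of 1-cells strictly (its coherence 2-cells are identities). A pseudofunctor $F\colon\mathcal{A}\to\mathcal{B}$ is a surjective equivalence if it is surjective on objects (for every $b\in\mathcal{B}$ there is $a\in\mathcal{A}$ with $Fa=b$) and for all objects $a,a'$ the functor $F\colon\mathcal{A}(a,a')\to\mathcal{B}(Fa,Fa')$ is surjective on objects, full and faithful. *)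

(* Defs.v *)
Record bicat_data : Type := {
  ob :> Type;
  hom : ob -> ob -> Type;
  cell : forall (a b : ob), hom a b -> hom a b -> Type;
  id1 : forall (a : ob), hom a a;
  comp1 : forall (a b c : ob), hom a b -> hom b c -> hom a c;
  id2 : forall (a b : ob) (f : hom a b), cell a b f f;
  vcomp : forall (a b : ob) (f g h : hom a b),
      cell a b f g -> cell a b g h -> cell a b f h;
  lwhisker : forall (a b c : ob) (f : hom a b) (g h : hom b c),
      cell b c g h -> cell a c (comp1 a b c f g) (comp1 a b c f h);
  rwhisker : forall (a b c : ob) (f g : hom a b) (h : hom b c),
      cell a b f g -> cell a c (comp1 a b c f h) (comp1 a b c g h);
  lunitor : forall (a b : ob) (f : hom a b), cell a b (comp1 a a b (id1 a) f) f;
  linvunitor : forall (a b : ob) (f : hom a b), cell a b f (comp1 a a b (id1 a) f);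
  runitor : forall (a b : ob) (f : hom a b), cell a b (comp1 a b b f (id1 b)) f;
  rinvunitor : forall (a b : ob) (f : hom a b), cell a b f (comp1 a b b f (id1 b));
  lassociator : forall (a b c d : ob) (f : hom a b) (g : hom b c) (h : hom c d),
      cell a d (comp1 a b d f (comp1 b c d g h)) (comp1 a c d (comp1 a b c f g) h);
  rassociator : forall (a b c d : ob) (f : hom a b) (g : hom b c) (h : hom c d),
      cell a d (comp1 a c d (comp1 a b c f g) h) (comp1 a b d f (comp1 b c d g h))
}.

Arguments hom {B} : rename.
Arguments cell {B a b} : rename.
Arguments id1 {B} a : rename.
Arguments comp1 {B a b c} : rename.
Arguments id2 {B a b} f : rename.
Arguments vcomp {B a b f g h} : rename.
Arguments lwhisker {B a b c} f {g h} : rename.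
Arguments rwhisker {B a b c f g} h : rename.
Arguments lunitor {B a b} f : rename.
Arguments linvunitor {B a b} f : rename.
Arguments runitor {B a b} f : rename.
Arguments rinvunitor {B a b} f : rename.
Arguments lassociator {B a b c d} f g h : rename.
Arguments rassociator {B a b c d} f g h : rename.

(* The bicategory axioms (UniMath's prebicat_laws). *)
Definition is_bicat (B : bicat_data) : Prop :=
  (forall (a b : B) (f g : hom a b) (x : cell f g), vcomp (id2 f) x = x) /\
  (forall (a b : B) (f g : hom a b) (x : cell f g), vcomp x (id2 g) = x) /\
  (forall (a b : B) (f g h k : hom a b) (x : cell f g) (y : cell g h) (z : cell h k),
      vcomp x (vcomp y z) = vcomp (vcomp x y) z) /\
  (forall (a b c : B) (f : hom a b) (g : hom b c),
      lwhisker f (id2 g) = id2 (comp1 f g)) /\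
  (forall (a b c : B) (f : hom a b) (g : hom b c),
      rwhisker g (id2 f) = id2 (comp1 f g)) /\
  (forall (a b c : B) (f : hom a b) (g h i : hom b c) (x : cell g h) (y : cell h i),
      vcomp (lwhisker f x) (lwhisker f y) = lwhisker f (vcomp x y)) /\
  (forall (a b c : B) (f g h : hom a b) (i : hom b c) (x : cell f g) (y : cell g h),
      vcomp (rwhisker i x) (rwhisker i y) = rwhisker i (vcomp x y)) /\
  (forall (a b : B) (f g : hom a b) (x : cell f g),
      vcomp (lwhisker (id1 a) x) (lunitor g) = vcomp (lunitor f) x) /\
  (forall (a b : B) (f g : hom a b) (x : cell f g),
      vcomp (rwhisker (id1 b) x) (runitor g) = vcomp (runitor f) x) /\
  (forall (a b c d : B) (f : hom a b) (g : hom b c) (h i : hom c d) (x : cell h i),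
      vcomp (lwhisker f (lwhisker g x)) (lassociator f g i)
      = vcomp (lassociator f g h) (lwhisker (comp1 f g) x)) /\
  (forall (a b c d : B) (f : hom a b) (g h : hom b c) (i : hom c d) (x : cell g h),
      vcomp (lwhisker f (rwhisker i x)) (lassociator f h i)
      = vcomp (lassociator f g i) (rwhisker i (lwhisker f x))) /\
  (forall (a b c d : B) (f g : hom a b) (h : hom b c) (i : hom c d) (x : cell f g),
      vcomp (lassociator f h i) (rwhisker i (rwhisker h x))
      = vcomp (rwhisker (comp1 h i) x) (lassociator g h i)) /\
  (forall (a b c : B) (f g : hom a b) (h i : hom b c) (x : cell f g) (y : cell h i),
      vcomp (rwhisker h x) (lwhisker g y) = vcomp (lwhisker f y) (rwhisker i x)) /\
  (forall (a b : B) (f : hom a b),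
      vcomp (lunitor f) (linvunitor f) = id2 (comp1 (id1 a) f)) /\
  (forall (a b : B) (f : hom a b), vcomp (linvunitor f) (lunitor f) = id2 f) /\
  (forall (a b : B) (f : hom a b),
      vcomp (runitor f) (rinvunitor f) = id2 (comp1 f (id1 b))) /\
  (forall (a b : B) (f : hom a b), vcomp (rinvunitor f) (runitor f) = id2 f) /\
  (forall (a b c d : B) (f : hom a b) (g : hom b c) (h : hom c d),
      vcomp (lassociator f g h) (rassociator f g h) = id2 (comp1 f (comp1 g h))) /\
  (forall (a b c d : B) (f : hom a b) (g : hom b c) (h : hom c d),
      vcomp (rassociator f g h) (lassociator f g h) = id2 (comp1 (comp1 f g) h)) /\
  (forall (a b c : B) (f : hom a b) (g : hom b c),
      vcomp (lassociator f (id1 b) g) (rwhisker g (runitor f))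
      = lwhisker f (lunitor g)) /\
  (forall (a b c d e : B) (k : hom a b) (f : hom b c) (g : hom c d) (h : hom d e),
      vcomp (vcomp (lwhisker k (lassociator f g h)) (lassociator k (comp1 f g) h))
            (rwhisker h (lassociator k f g))
      = vcomp (lassociator k f (comp1 g h)) (lassociator (comp1 k f) g h)).

Record Bicat : Type := {
  bicat_data_of :> bicat_data;
  bicat_laws : is_bicat bicat_data_of
}.

Definition is_invertible {B : bicat_data} {a b : B} {f g : hom a b} (x : cell f g) : Prop :=
  exists y : cell g f, vcomp x y = id2 f /\ vcomp y x = id2 g.

Definition cell_of_eq {B : bicat_data} {a b : B} {f g : hom a b} (e : f = g) : cell f g :=
  match e in _ = g' return cell f g' with eq_refl => id2 f end.

Record psfunctor_data (A B : bicat_data) : Type := {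
  F0 :> A -> B;
  F1 : forall (a b : A), hom a b -> hom (F0 a) (F0 b);
  F2 : forall (a b : A) (f g : hom a b), cell f g -> cell (F1 a b f) (F1 a b g);
  Fid : forall (a : A), cell (id1 (F0 a)) (F1 a a (id1 a));
  Fcomp : forall (a b c : A) (f : hom a b) (g : hom b c),
      cell (comp1 (F1 a b f) (F1 b c g)) (F1 a c (comp1 f g))
}.

Arguments F0 {A B} F a : rename.
Arguments F1 {A B} F {a b} f : rename.
Arguments F2 {A B} F {a b f g} x : rename.
Arguments Fid {A B} F a : rename.
Arguments Fcomp {A B} F {a b c} f g : rename.

Definition is_psfunctor {A B : bicat_data} (F : psfunctor_data A B) : Prop :=
  (forall (a b : A) (f : hom a b), F2 F (id2 f) = id2 (F1 F f)) /\
  (forall (a b : A) (f g h : hom a b) (x : cell f g) (y : cell g h),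
      F2 F (vcomp x y) = vcomp (F2 F x) (F2 F y)) /\
  (forall (a b : A) (f : hom a b),
      lunitor (F1 F f)
      = vcomp (vcomp (rwhisker (F1 F f) (Fid F a)) (Fcomp F (id1 a) f)) (F2 F (lunitor f))) /\
  (forall (a b : A) (f : hom a b),
      runitor (F1 F f)
      = vcomp (vcomp (lwhisker (F1 F f) (Fid F b)) (Fcomp F f (id1 b))) (F2 F (runitor f))) /\
  (forall (a b c d : A) (f : hom a b) (g : hom b c) (h : hom c d),
      vcomp (vcomp (lwhisker (F1 F f) (Fcomp F g h)) (Fcomp F f (comp1 g h)))
            (F2 F (lassociator f g h))
      = vcomp (vcomp (lassociator (F1 F f) (F1 F g) (F1 F h))
                     (rwhisker (F1 F h) (Fcomp F f g)))
              (Fcomp F (comp1 f g) h)) /\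
  (forall (a b c : A) (f : hom a b) (g1 g2 : hom b c) (x : cell g1 g2),
      vcomp (lwhisker (F1 F f) (F2 F x)) (Fcomp F f g2)
      = vcomp (Fcomp F f g1) (F2 F (lwhisker f x))) /\
  (forall (a b c : A) (f1 f2 : hom a b) (g : hom b c) (x : cell f1 f2),
      vcomp (rwhisker (F1 F g) (F2 F x)) (Fcomp F f2 g)
      = vcomp (Fcomp F f1 g) (F2 F (rwhisker g x))) /\
  (forall a : A, is_invertible (Fid F a)) /\
  (forall (a b c : A) (f : hom a b) (g : hom b c), is_invertible (Fcomp F f g)).

Record psfunctor (A B : Bicat) : Type := {
  psfunctor_data_of :> psfunctor_data A B;
  psfunctor_laws : is_psfunctor psfunctor_data_of
}.

Definition id_psfunctor (A : bicat_data) : psfunctor_data A A :=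
  {| F0 := fun a => a;
     F1 := fun a b f => f;
     F2 := fun a b f g x => x;
     Fid := fun a => id2 (id1 a);
     Fcomp := fun a b c f g => id2 (comp1 f g) |}.

Definition comp_psfunctor {A B C : bicat_data}
    (F : psfunctor_data A B) (G : psfunctor_data B C) : psfunctor_data A C :=
  {| F0 := fun a => G (F a);
     F1 := fun a b f => F1 G (F1 F f);
     F2 := fun a b f g x => F2 G (F2 F x);
     Fid := fun a => vcomp (Fid G (F a)) (F2 G (Fid F a));
     Fcomp := fun a b c f g => vcomp (Fcomp G (F1 F f) (F1 F g)) (F2 G (Fcomp F f g)) |}.

Record pstrans_data {A B : bicat_data} (F G : psfunctor_data A B) : Type := {
  pscomp :> forall a : A, hom (F a) (G a);
  psnat : forall (a b : A) (f : hom a b),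
      cell (comp1 (pscomp a) (F1 G f)) (comp1 (F1 F f) (pscomp b))
}.

Arguments pscomp {A B F G} s a : rename.
Arguments psnat {A B F G} s {a b} f : rename.

Definition is_pstrans {A B : bicat_data} {F G : psfunctor_data A B}
    (s : pstrans_data F G) : Prop :=
  (forall (a b : A) (f : hom a b), is_invertible (psnat s f)) /\
  (forall (a b : A) (f g : hom a b) (x : cell f g),
      vcomp (lwhisker (s a) (F2 G x)) (psnat s g)
      = vcomp (psnat s f) (rwhisker (s b) (F2 F x))) /\
  (forall a : A,
      vcomp (lwhisker (s a) (Fid G a)) (psnat s (id1 a))
      = vcomp (vcomp (runitor (s a)) (linvunitor (s a))) (rwhisker (s a) (Fid F a))) /\
  (forall (a b c : A) (f : hom a b) (g : hom b c),
      vcomp (lwhisker (s a) (Fcomp G f g)) (psnat s (comp1 f g))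
      = vcomp (vcomp (vcomp (vcomp (vcomp
          (lassociator (s a) (F1 G f) (F1 G g))
          (rwhisker (F1 G g) (psnat s f)))
          (rassociator (F1 F f) (s b) (F1 G g)))
          (lwhisker (F1 F f) (psnat s g)))
          (lassociator (F1 F f) (F1 F g) (s c)))
          (rwhisker (s c) (Fcomp F f g))).

Definition id_pstrans {A B : bicat_data} (F : psfunctor_data A B) : pstrans_data F F :=
  {| pscomp := fun a => id1 (F a);
     psnat := fun a b f => vcomp (lunitor (F1 F f)) (rinvunitor (F1 F f)) |}.

Definition comp_pstrans {A B : bicat_data} {F G H : psfunctor_data A B}
    (s : pstrans_data F G) (t : pstrans_data G H) : pstrans_data F H :=
  {| pscomp := fun a => comp1 (s a) (t a);
     psnat := fun a b f =>
       vcomp (vcomp (vcomp (vcomp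
         (rassociator (s a) (t a) (F1 H f))
         (lwhisker (s a) (psnat t f)))
         (lassociator (s a) (F1 G f) (t b)))
         (rwhisker (t b) (psnat s f)))
         (rassociator (F1 F f) (s b) (t b)) |}.

Definition is_modification {A B : bicat_data} {F G : psfunctor_data A B}
    (s t : pstrans_data F G) (m : forall a : A, cell (s a) (t a)) : Prop :=
  forall (a b : A) (f : hom a b),
    vcomp (rwhisker (F1 G f) (m a)) (psnat t f)
    = vcomp (psnat s f) (lwhisker (F1 F f) (m b)).

(* Invertible 2-cell of [A,B]: a modification with an inverse modification
   (composition and identities of modifications are componentwise). *)
Definition is_invertible_modification {A B : bicat_data} {F G : psfunctor_data A B}
    (s t : pstrans_data F G) (m : forall a : A, cell (s a) (t a)) : Prop :=
  is_modification s t m /\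
  exists m' : forall a : A, cell (t a) (s a),
    is_modification t s m' /\
    (forall a : A, vcomp (m a) (m' a) = id2 (s a)) /\
    (forall a : A, vcomp (m' a) (m a) = id2 (t a)).

Definition equivalent_in_functor_bicat {A B : bicat_data}
    (F G : psfunctor_data A B) : Prop :=
  exists (s : pstrans_data F G) (t : pstrans_data G F),
    is_pstrans s /\ is_pstrans t /\
    (exists eta : forall a : A, cell (id_pstrans F a) (comp_pstrans s t a),
        is_invertible_modification (id_pstrans F) (comp_pstrans s t) eta) /\
    (exists eps : forall a : A, cell (comp_pstrans t s a) (id_pstrans G a),
        is_invertible_modification (comp_pstrans t s) (id_pstrans G) eps).

Definition biequivalent (A B : Bicat) : Prop :=
  exists (F : psfunctor A B) (G : psfunctor B A),
    equivalent_in_functor_bicat (comp_psfunctor F G) (id_psfunctor A) /\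
    equivalent_in_functor_bicat (comp_psfunctor G F) (id_psfunctor B).

Definition is_strict {A B : bicat_data} (F : psfunctor_data A B) : Prop :=
  (forall a : A, exists e : id1 (F a) = F1 F (id1 a), Fid F a = cell_of_eq e) /\
  (forall (a b c : A) (f : hom a b) (g : hom b c),
      exists e : comp1 (F1 F f) (F1 F g) = F1 F (comp1 f g), Fcomp F f g = cell_of_eq e).

Definition is_surjective_equivalence {A B : bicat_data} (F : psfunctor_data A B) : Prop :=
  (forall b : B, exists a : A, F a = b) /\
  (forall a a' : A,
     (forall g : hom (F a) (F a'), exists f : hom a a', F1 F f = g) /\
     (forall (f f' : hom a a') (y : cell (F1 F f) (F1 F f')), exists x : cell f f', F2 F x = y) /\
     (forall (f f' : hom a a') (x x' : cell f f'), F2 F x = F2 F x' -> x = x')).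

(* Main.v *)
(* A span of strict surjective equivalences gives a biequivalence because biequivalence is an
   equivalence relation and a surjective equivalence [P : C -> A] factors as [C -> pull P -> A],
   where [pull P] has the objects of [C] and the hom categories of [A]: the first functor is the
   identity on objects, the second one on hom categories, so each is easy to invert.

   Conversely, given a biequivalence [F : A -> B], let [C] be the bicategory whose objects are the
   equivalences [w : F a -> b], whose 1-cells [w -> w'] are squares [F f ; w' ~ w ; g], and whose
   2-cells are the compatible pairs of 2-cells.  Both projections are strict; they are surjective
   equivalences because composing with an equivalence is an equivalence of hom categories and
   because [F] is one on hom categories.

   Equalities of pasted 2-cells are reduced to computations without associators and unitors, by
   letting every 2-cell act on left-bracketed composites of 1-cells. *)
Require Import Defs.
From Stdlib Require Import FunctionalExtensionality ProofIrrelevance ClassicalEpsilon.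
Set Implicit Arguments. Unset Strict Implicit.

(** An equivalence in a functor bicategory is awkward to compose: its inverse and both modifications
    would have to be pasted as well. It is therefore traded for a single pseudonatural
    transformation whose components are equivalences. Components can be improved to adjoint
    equivalences, and the mates of the naturality 2-cells then form an inverse transformation for
    which the units and counits are modifications. In this form transitivity of biequivalence needs
    only vertical composition and whiskering by pseudofunctors. The action on left-bracketed
    composites is a Yoneda device: left whiskering becomes a change of argument, associators and
    unitors act as identities, and what remains is right whiskering, interchange and the given
    axioms. No coherence theorem is invoked. Choice selects inverses and lifts. Functional
    extensionality makes composition of pseudofunctors associative and unital on the nose. Proof
    irrelevance lets 2-cells of [C] be compared by their two components. *)

Section Laws.
Context {B : Bicat}.
Implicit Types a b c d e : B.

Ltac law := intros; pose proof (bicat_laws B) as H; unfold is_bicat in H;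
  decompose [and] H; eauto.

Lemma id2_left a b (f g : hom a b) (x : cell f g) : vcomp (id2 f) x = x.
Proof. law. Qed.
Lemma id2_right a b (f g : hom a b) (x : cell f g) : vcomp x (id2 g) = x.
Proof. law. Qed.
(** Oriented against the axiom: right-bracketed vertical composites are the normal form of all later
    rewriting. *)
Lemma vassoc a b (f g h k : hom a b) (x : cell f g) (y : cell g h) (z : cell h k) :
  vcomp (vcomp x y) z = vcomp x (vcomp y z).
Proof. symmetry; law. Qed.
Lemma lwhisker_id2 a b c (f : hom a b) (g : hom b c) :
  lwhisker f (id2 g) = id2 (comp1 f g).
Proof. law. Qed.
Lemma id2_rwhisker a b c (f : hom a b) (g : hom b c) :
  rwhisker g (id2 f) = id2 (comp1 f g).
Proof. law. Qed.
Lemma lwhisker_vcomp a b c (f : hom a b) (g h i : hom b c) (x : cell g h) (y : cell h i) :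
  lwhisker f (vcomp x y) = vcomp (lwhisker f x) (lwhisker f y).
Proof. symmetry; law. Qed.
Lemma rwhisker_vcomp a b c (f g h : hom a b) (i : hom b c) (x : cell f g) (y : cell g h) :
  rwhisker i (vcomp x y) = vcomp (rwhisker i x) (rwhisker i y).
Proof. symmetry; law. Qed.
Lemma lunitor_nat a b (f g : hom a b) (x : cell f g) :
  vcomp (lwhisker (id1 a) x) (lunitor g) = vcomp (lunitor f) x.
Proof. law. Qed.
Lemma runitor_nat a b (f g : hom a b) (x : cell f g) :
  vcomp (rwhisker (id1 b) x) (runitor g) = vcomp (runitor f) x.
Proof. law. Qed.
Lemma lwhisker_lwhisker a b c d (f : hom a b) (g : hom b c) (h i : hom c d) (x : cell h i) :
  vcomp (lwhisker f (lwhisker g x)) (lassociator f g i)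
  = vcomp (lassociator f g h) (lwhisker (comp1 f g) x).
Proof. law. Qed.
Lemma rwhisker_lwhisker a b c d (f : hom a b) (g h : hom b c) (i : hom c d) (x : cell g h) :
  vcomp (lwhisker f (rwhisker i x)) (lassociator f h i)
  = vcomp (lassociator f g i) (rwhisker i (lwhisker f x)).
Proof. law. Qed.
Lemma rwhisker_rwhisker a b c d (f g : hom a b) (h : hom b c) (i : hom c d) (x : cell f g) :
  vcomp (lassociator f h i) (rwhisker i (rwhisker h x))
  = vcomp (rwhisker (comp1 h i) x) (lassociator g h i).
Proof. law. Qed.
Lemma whisker_exchange a b c (f g : hom a b) (h i : hom b c) (x : cell f g) (y : cell h i) :
  vcomp (rwhisker h x) (lwhisker g y) = vcomp (lwhisker f y) (rwhisker i x).
Proof. law. Qed.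
Lemma lunitor_linvunitor a b (f : hom a b) :
  vcomp (lunitor f) (linvunitor f) = id2 (comp1 (id1 a) f).
Proof. law. Qed.
Lemma linvunitor_lunitor a b (f : hom a b) : vcomp (linvunitor f) (lunitor f) = id2 f.
Proof. law. Qed.
Lemma runitor_rinvunitor a b (f : hom a b) :
  vcomp (runitor f) (rinvunitor f) = id2 (comp1 f (id1 b)).
Proof. law. Qed.
Lemma rinvunitor_runitor a b (f : hom a b) : vcomp (rinvunitor f) (runitor f) = id2 f.
Proof. law. Qed.
Lemma lassociator_rassociator a b c d (f : hom a b) (g : hom b c) (h : hom c d) :
  vcomp (lassociator f g h) (rassociator f g h) = id2 (comp1 f (comp1 g h)).
Proof. law. Qed.
Lemma rassociator_lassociator a b c d (f : hom a b) (g : hom b c) (h : hom c d) :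
  vcomp (rassociator f g h) (lassociator f g h) = id2 (comp1 (comp1 f g) h).
Proof. law. Qed.
Lemma unit_triangle a b c (f : hom a b) (g : hom b c) :
  vcomp (lassociator f (id1 b) g) (rwhisker g (runitor f)) = lwhisker f (lunitor g).
Proof. law. Qed.
Lemma pentagon a b c d e (k : hom a b) (f : hom b c) (g : hom c d) (h : hom d e) :
  vcomp (lwhisker k (lassociator f g h))
    (vcomp (lassociator k (comp1 f g) h) (rwhisker h (lassociator k f g)))
  = vcomp (lassociator k f (comp1 g h)) (lassociator (comp1 k f) g h).
Proof. rewrite <- vassoc. law. Qed.

(** ** Invertible 2-cells *)

Definition inverse_pair {a b} {f g : hom a b} (x : cell f g) (y : cell g f) : Prop :=
  vcomp x y = id2 f /\ vcomp y x = id2 g.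

Lemma inv_cancel_left a b (f g h : hom a b) (x : cell f g) (y y' : cell g h) :
  is_invertible x -> vcomp x y = vcomp x y' -> y = y'.
Proof.
  intros [z [_ Hz]] H. rewrite <- (id2_left y), <- (id2_left y'), <- Hz, !vassoc, H.
  reflexivity.
Qed.

Lemma inv_cancel_right a b (f g h : hom a b) (x : cell g h) (y y' : cell f g) :
  is_invertible x -> vcomp y x = vcomp y' x -> y = y'.
Proof.
  intros [z [Hz _]] H. rewrite <- (id2_right y), <- (id2_right y'), <- Hz, <- !vassoc, H.
  reflexivity.
Qed.

Lemma invertible_id2 a b (f : hom a b) : is_invertible (id2 f).
Proof. exists (id2 f). rewrite id2_left. auto. Qed.

Lemma invertible_vcomp a b (f g h : hom a b) (x : cell f g) (y : cell g h) :
  is_invertible x -> is_invertible y -> is_invertible (vcomp x y).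
Proof.
  intros [x' [H1 H2]] [y' [H3 H4]]. exists (vcomp y' x'). split.
  - rewrite vassoc, <- (vassoc y), H3, id2_left; exact H1.
  - rewrite vassoc, <- (vassoc x'), H2, id2_left; exact H4.
Qed.

Lemma invertible_lwhisker a b c (f : hom a b) (g h : hom b c) (x : cell g h) :
  is_invertible x -> is_invertible (lwhisker f x).
Proof.
  intros [y [H1 H2]]. exists (lwhisker f y).
  rewrite <- !lwhisker_vcomp, H1, H2, !lwhisker_id2. auto.
Qed.

Lemma invertible_rwhisker a b c (f g : hom a b) (h : hom b c) (x : cell f g) :
  is_invertible x -> is_invertible (rwhisker h x).
Proof.
  intros [y [H1 H2]]. exists (rwhisker h y).
  rewrite <- !rwhisker_vcomp, H1, H2, !id2_rwhisker. auto.
Qed.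

Lemma invertible_lassociator a b c d (f : hom a b) (g : hom b c) (h : hom c d) :
  is_invertible (lassociator f g h).
Proof.
  exists (rassociator f g h). split;
  [apply lassociator_rassociator | apply rassociator_lassociator].
Qed.

Lemma invertible_rassociator a b c d (f : hom a b) (g : hom b c) (h : hom c d) :
  is_invertible (rassociator f g h).
Proof.
  exists (lassociator f g h). split;
  [apply rassociator_lassociator | apply lassociator_rassociator].
Qed.

Lemma invertible_lunitor a b (f : hom a b) : is_invertible (lunitor f).
Proof.
  exists (linvunitor f). split; [apply lunitor_linvunitor | apply linvunitor_lunitor].
Qed.

Lemma invertible_linvunitor a b (f : hom a b) : is_invertible (linvunitor f).
Proof.
  exists (lunitor f). split; [apply linvunitor_lunitor | apply lunitor_linvunitor].
Qed.

Lemma invertible_runitor a b (f : hom a b) : is_invertible (runitor f).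
Proof.
  exists (rinvunitor f). split; [apply runitor_rinvunitor | apply rinvunitor_runitor].
Qed.

Lemma invertible_rinvunitor a b (f : hom a b) : is_invertible (rinvunitor f).
Proof.
  exists (runitor f). split; [apply rinvunitor_runitor | apply runitor_rinvunitor].
Qed.

Definition inv {a b} {f g : hom a b} (x : cell f g) (H : is_invertible x) : cell g f :=
  proj1_sig (constructive_indefinite_description _ H).

Lemma vcomp_inv a b (f g : hom a b) (x : cell f g) (H : is_invertible x) :
  vcomp x (inv H) = id2 f.
Proof. unfold inv; destruct constructive_indefinite_description as [y [? ?]]; auto. Qed.

Lemma inv_vcomp a b (f g : hom a b) (x : cell f g) (H : is_invertible x) :
  vcomp (inv H) x = id2 g.
Proof. unfold inv; destruct constructive_indefinite_description as [y [? ?]]; auto. Qed.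

Lemma invertible_inv a b (f g : hom a b) (x : cell f g) (H : is_invertible x) :
  is_invertible (inv H).
Proof. exists x. split; [apply inv_vcomp | apply vcomp_inv]. Qed.

(** Kelly's argument. Whiskering with [id1 c] is faithful by naturality of the right unitor, and
    after it both sides agree by the pentagon for [f], [g] and two identities together with the unit
    triangle. The 2-cell cancelled on the left consists of the first two edges of that pentagon. *)
Lemma runitor_triangle a b c (f : hom a b) (g : hom b c) :
  vcomp (lassociator f g (id1 c)) (runitor (comp1 f g)) = lwhisker f (runitor g).
Proof.
  assert (faithful : forall (x y : cell (comp1 f (comp1 g (id1 c))) (comp1 f g)),
    rwhisker (id1 c) x = rwhisker (id1 c) y -> x = y).
  { intros x y H. apply (inv_cancel_left (invertible_runitor _)).
    now rewrite <- !runitor_nat, H. }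
  apply faithful.
  apply (inv_cancel_left (invertible_vcomp
    (invertible_lwhisker f (invertible_lassociator g (id1 c) (id1 c)))
    (invertible_lassociator f (comp1 g (id1 c)) (id1 c)))).
  rewrite rwhisker_vcomp, <- (vassoc _ (rwhisker _ (lassociator _ _ _))).
  rewrite (vassoc (lwhisker _ _) (lassociator _ _ _)), pentagon.
  rewrite vassoc, unit_triangle, <- lwhisker_lwhisker.
  rewrite vassoc, <- rwhisker_lwhisker, <- vassoc, <- lwhisker_vcomp, unit_triangle.
  reflexivity.
Qed.

(** ** Strictification *)

(* Formal composites of 1-cells.  A formal composite [s] from [a] to [b] sends [u : hom x a] to
   the left-bracketed composite [act s u], in which identities are dropped; conjugating by the
   canonical isomorphism [u s ~ act s u] turns a 2-cell [al : s => t] into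
   [act2 s t u al : act s u => act t u].  All associators and unitors become identities
   under [act2], and [act2] is faithful. *)
Inductive path : B -> B -> Type :=
| Pid a : path a a
| Pv a b (f : hom a b) : path a b
| Pc a b c (s : path a b) (t : path b c) : path a c.

Fixpoint ev {a b} (s : path a b) : hom a b :=
  match s with Pid a => id1 a | Pv f => f | Pc s t => comp1 (ev s) (ev t) end.

Fixpoint act {a b} (s : path a b) {x : B} : hom x a -> hom x b :=
  match s in path a b return hom x a -> hom x b with
  | Pid a => fun u => u
  | Pv f => fun u => comp1 u f
  | Pc s t => fun u => act t (act s u)
  end.

Fixpoint can {a b} (s : path a b) {x : B} : forall u : hom x a, cell (comp1 u (ev s)) (act s u) :=
  match s in path a b return forall u : hom x a, cell (comp1 u (ev s)) (act s u) with
  | Pid a => fun u => runitor u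
  | Pv f => fun u => id2 (comp1 u f)
  | Pc s t => fun u => vcomp (lassociator u (ev s) (ev t))
                        (vcomp (rwhisker (ev t) (can s u)) (can t (act s u)))
  end.

Fixpoint actr {a b} (s : path a b) {x : B} :
  forall u v : hom x a, cell u v -> cell (act s u) (act s v) :=
  match s in path a b return forall u v : hom x a, cell u v -> cell (act s u) (act s v) with
  | Pid a => fun u v z => z
  | Pv f => fun u v z => rwhisker f z
  | Pc s t => fun u v z => actr t (actr s z)
  end.

Lemma invertible_can a b (s : path a b) x (u : hom x a) : is_invertible (can s u).
Proof.
  revert x u; induction s; intros x u; simpl.
  - apply invertible_runitor.
  - apply invertible_id2.
  - repeat apply invertible_vcomp; auto using invertible_lassociator, invertible_rwhisker.
Qed.

Lemma can_nat a b (s : path a b) x (u v : hom x a) (z : cell u v) :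
  vcomp (rwhisker (ev s) z) (can s v) = vcomp (can s u) (actr s z).
Proof.
  revert x u v z; induction s; intros x u v z; simpl.
  - apply runitor_nat.
  - now rewrite id2_left, id2_right.
  - rewrite <- vassoc, <- rwhisker_rwhisker, !vassoc. f_equal.
    rewrite <- IHs2, <- !vassoc. f_equal.
    rewrite <- !rwhisker_vcomp. f_equal. apply IHs1.
Qed.

Definition act2 {a b} (s t : path a b) {x} (u : hom x a) (al : cell (ev s) (ev t)) :
  cell (act s u) (act t u) :=
  vcomp (inv (invertible_can s u)) (vcomp (lwhisker u al) (can t u)).
Arguments act2 {a b} s t {x} u al.

Lemma act2_unique a b (s t : path a b) x (u : hom x a) (al : cell (ev s) (ev t)) y :
  vcomp (lwhisker u al) (can t u) = vcomp (can s u) y -> act2 s t u al = y.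
Proof.
  intros H. unfold act2. rewrite H, <- vassoc, inv_vcomp. apply id2_left.
Qed.

Lemma can_act2 a b (s t : path a b) x (u : hom x a) (al : cell (ev s) (ev t)) :
  vcomp (can s u) (act2 s t u al) = vcomp (lwhisker u al) (can t u).
Proof. unfold act2. now rewrite <- vassoc, vcomp_inv, id2_left. Qed.

(** The argument [u = id1 a] already suffices, because whiskering with an identity on the left is
    faithful by naturality of the left unitor. *)
Lemma act2_faithful a b (s t : path a b) (al be : cell (ev s) (ev t)) :
  (forall x (u : hom x a), act2 s t u al = act2 s t u be) -> al = be.
Proof.
  intros H. specialize (H a (id1 a)). apply (f_equal (vcomp (can s (id1 a)))) in H.
  rewrite !can_act2 in H. apply (inv_cancel_right (invertible_can _ _)) in H.
  apply (inv_cancel_left (invertible_lunitor _)). now rewrite <- !lunitor_nat, H.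
Qed.

Lemma act2_id2 a b (s : path a b) x (u : hom x a) :
  act2 s s u (id2 (ev s)) = id2 (act s u).
Proof. apply act2_unique. now rewrite lwhisker_id2, id2_left, id2_right. Qed.

Lemma act2_vcomp a b (s m t : path a b) x (u : hom x a)
  (al : cell (ev s) (ev m)) (be : cell (ev m) (ev t)) :
  act2 s t u (vcomp al be) = vcomp (act2 s m u al) (act2 m t u be).
Proof.
  apply act2_unique.
  now rewrite <- vassoc, can_act2, vassoc, can_act2, lwhisker_vcomp, vassoc.
Qed.

Arguments act2_vcomp {a b} s m t {x} u al be.

(** Left whiskering is absorbed into the argument, so translated equations contain right whiskerings
    only. *)
Lemma act2_lwhisker a b c (s : path a b) (t t' : path b c) x (u : hom x a)
  (al : cell (ev t) (ev t')) :
  act2 (Pc s t) (Pc s t') u (lwhisker (ev s) al) = act2 t t' (act s u) al.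
Proof.
  apply act2_unique; simpl.
  rewrite !vassoc, can_act2, <- !vassoc. f_equal.
  rewrite lwhisker_lwhisker, !vassoc. f_equal. symmetry. apply whisker_exchange.
Qed.

Lemma act2_rwhisker a b c (s s' : path a b) (t : path b c) x (u : hom x a)
  (al : cell (ev s) (ev s')) :
  act2 (Pc s t) (Pc s' t) u (rwhisker (ev t) al) = actr t (act2 s s' u al).
Proof.
  apply act2_unique; simpl.
  rewrite !vassoc, <- can_nat, <- vassoc, rwhisker_lwhisker, !vassoc. f_equal.
  rewrite <- !vassoc. f_equal. rewrite <- !rwhisker_vcomp. f_equal.
  symmetry. apply can_act2.
Qed.

(** The two ways of moving [u] through the three factors are compared by the pentagon. *)
Lemma act2_lassociator a b c d (s : path a b) (t : path b c) (r : path c d) x (u : hom x a) :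
  act2 (Pc s (Pc t r)) (Pc (Pc s t) r) u (lassociator (ev s) (ev t) (ev r))
  = id2 (act r (act t (act s u))).
Proof.
  apply act2_unique; simpl.
  rewrite id2_right, !rwhisker_vcomp, !vassoc.
  rewrite <- (vassoc (rwhisker _ (can s u)) (lassociator _ _ _)), <- rwhisker_rwhisker.
  rewrite <- (vassoc (lassociator u _ _)). rewrite !vassoc.
  rewrite <- (vassoc (lassociator u _ _) (lassociator _ _ _)), <- pentagon, !vassoc.
  reflexivity.
Qed.

Lemma act2_rassociator a b c d (s : path a b) (t : path b c) (r : path c d) x (u : hom x a) :
  act2 (Pc (Pc s t) r) (Pc s (Pc t r)) u (rassociator (ev s) (ev t) (ev r))
  = id2 (act r (act t (act s u))).
Proof.
  pose proof (act2_vcomp (Pc (Pc s t) r) (Pc s (Pc t r)) (Pc (Pc s t) r) u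
    (rassociator (ev s) (ev t) (ev r)) (lassociator (ev s) (ev t) (ev r))) as H.
  simpl ev in H.
  rewrite rassociator_lassociator, act2_lassociator in H.
  change (act r _) with (act (Pc s (Pc t r)) u) in H. rewrite id2_right in H.
  rewrite <- H. apply (act2_id2 (Pc (Pc s t) r)).
Qed.

Lemma act2_lunitor a b (s : path a b) x (u : hom x a) :
  act2 (Pc (Pid a) s) s u (lunitor (ev s)) = id2 (act s u).
Proof.
  apply act2_unique; simpl.
  now rewrite id2_right, <- vassoc, unit_triangle.
Qed.

Lemma act2_linvunitor a b (s : path a b) x (u : hom x a) :
  act2 s (Pc (Pid a) s) u (linvunitor (ev s)) = id2 (act s u).
Proof.
  pose proof (act2_vcomp s (Pc (Pid a) s) s u (linvunitor (ev s)) (lunitor (ev s))) as H.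
  rewrite linvunitor_lunitor, act2_lunitor in H.
  transitivity (act2 s s u (id2 (ev s))); [| exact (act2_id2 s u)].
  rewrite H. symmetry. apply (id2_right (act2 s (Pc (Pid a) s) u _)).
Qed.

Lemma act2_runitor a b (s : path a b) x (u : hom x a) :
  act2 (Pc s (Pid b)) s u (runitor (ev s)) = id2 (act s u).
Proof.
  apply act2_unique; simpl.
  now rewrite id2_right, runitor_nat, <- vassoc, runitor_triangle.
Qed.

Lemma act2_rinvunitor a b (s : path a b) x (u : hom x a) :
  act2 s (Pc s (Pid b)) u (rinvunitor (ev s)) = id2 (act s u).
Proof.
  pose proof (act2_vcomp s (Pc s (Pid b)) s u (rinvunitor (ev s)) (runitor (ev s))) as H.
  rewrite rinvunitor_runitor, act2_runitor in H.
  transitivity (act2 s s u (id2 (ev s))); [| exact (act2_id2 s u)].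
  rewrite H. symmetry. apply (id2_right (act2 s (Pc s (Pid b)) u _)).
Qed.

(** The interchange law in translated form: a 2-cell on the initial stretch of a composite commutes
    with one on the remaining stretch. *)
Lemma act2_exchange a b (s t : path a b) x (u v : hom x a) (z : cell u v)
  (al : cell (ev s) (ev t)) :
  vcomp (actr s z) (act2 s t v al) = vcomp (act2 s t u al) (actr t z).
Proof.
  apply (inv_cancel_left (invertible_can s u)).
  rewrite <- !vassoc, <- can_nat, can_act2, !vassoc, can_act2, <- can_nat.
  rewrite <- !vassoc. f_equal. apply whisker_exchange.
Qed.

End Laws.

Arguments path {B} a b.
Arguments Pid {B} a.
Arguments act2 {B a b} s t {x} u al.
Arguments act2_vcomp {B a b} s m t {x} u al be.
Arguments act2_lwhisker {B a b c} s t t' {x} u al.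
Arguments act2_rwhisker {B a b c} s s' t {x} u al.
Arguments act2_exchange {B a b} s t {x} [u v] z al.

(** * Rewriting inside vertical composites and under right whiskerings *)

(** Prolongs an equation by an arbitrary tail [z], so that its left side can be found in the middle
    of a right-bracketed composite; [chain3] and [chain4] do the same for longer left sides. *)
Lemma chain2 {B : Bicat} {a b : B} {f g h : hom a b} {x : cell f g} {y : cell g h} {r} :
  vcomp x y = r -> forall k (z : cell h k), vcomp x (vcomp y z) = vcomp r z.
Proof. intros <- k z. now rewrite vassoc. Qed.

Lemma chain3 {B : Bicat} {a b : B} {f g h i : hom a b}
  {x : cell f g} {y : cell g h} {w : cell h i} {r} :
  vcomp x (vcomp y w) = r -> forall k (z : cell i k), vcomp x (vcomp y (vcomp w z)) = vcomp r z.
Proof. intros <- k z. now rewrite !vassoc. Qed.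

Lemma chain4 {B : Bicat} {a b : B} {f g h i j : hom a b}
  {x : cell f g} {y : cell g h} {w : cell h i} {v : cell i j} {r} :
  vcomp x (vcomp y (vcomp w v)) = r ->
  forall k (z : cell j k), vcomp x (vcomp y (vcomp w (vcomp v z))) = vcomp r z.
Proof. intros <- k z. now rewrite !vassoc. Qed.

Lemma wh2 {B : Bicat} {a b c : B} (k : hom b c) {f g h : hom a b}
  {x : cell f g} {y : cell g h} {r} :
  vcomp x y = r -> vcomp (rwhisker k x) (rwhisker k y) = rwhisker k r.
Proof. intros <-. now rewrite rwhisker_vcomp. Qed.

Lemma wh3 {B : Bicat} {a b c : B} (k : hom b c) {f g h i : hom a b}
  {x : cell f g} {y : cell g h} {z : cell h i} {r} :
  vcomp x (vcomp y z) = r ->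
  vcomp (rwhisker k x) (vcomp (rwhisker k y) (rwhisker k z)) = rwhisker k r.
Proof. intros <-. now rewrite !rwhisker_vcomp. Qed.

Ltac vnorm := rewrite ?rwhisker_vcomp, ?id2_rwhisker, ?id2_left, ?id2_right, ?vassoc.
Ltac vnorm_in H :=
  rewrite ?rwhisker_vcomp, ?id2_rwhisker, ?id2_left, ?id2_right, ?vassoc in H.

(** The chain and whiskering lemmas expect a proof of an equation, not of a quantified statement, so
    [K] is applied to as many holes as it needs. *)
Ltac saturate K tac :=
  first [tac uconstr:(K) | tac uconstr:(K _) | tac uconstr:(K _ _) | tac uconstr:(K _ _ _)
    | tac uconstr:(K _ _ _ _) | tac uconstr:(K _ _ _ _ _) | tac uconstr:(K _ _ _ _ _ _)
    | tac uconstr:(K _ _ _ _ _ _ _) | tac uconstr:(K _ _ _ _ _ _ _ _)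
    | tac uconstr:(K _ _ _ _ _ _ _ _ _) | tac uconstr:(K _ _ _ _ _ _ _ _ _ _)].
Ltac chain_rewrite E :=
  first [rewrite E | rewrite (chain2 E) | rewrite (chain3 E) | rewrite (chain4 E)].
Ltac chain_rewrite_back E := chain_rewrite uconstr:(eq_sym E).
Ltac wh_rewrite E :=
  first [chain_rewrite uconstr:(wh2 _ E) | chain_rewrite uconstr:(wh3 _ E)
        | chain_rewrite uconstr:(f_equal (rwhisker _) E)].
Ltac wwh_rewrite E := wh_rewrite uconstr:(wh2 _ E).
Ltac wh_rewrite_back E := wh_rewrite uconstr:(eq_sym E).
Ltac vrw_with H tac :=
  let K := fresh in
  pose proof H as K; cbn [act actr ev] in K |- *; vnorm_in K; saturate K tac; clear K; vnorm.

(* Rewriting in a right-bracketed vertical composite; [wrw] and [wwrw] rewrite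
   below one and two right whiskerings. *)
Tactic Notation "vrw" constr(H) := vrw_with H chain_rewrite.
Tactic Notation "vrw" "<-" constr(H) := vrw_with H chain_rewrite_back.
Tactic Notation "wrw" constr(H) := vrw_with H wh_rewrite.
Tactic Notation "wwrw" constr(H) := vrw_with H wwh_rewrite.
Tactic Notation "wrw" "<-" constr(H) := vrw_with H wh_rewrite_back.

(** * Tactics translating equations of 2-cells into the action *)

Ltac reify f :=
  lazymatch f with
  | comp1 ?g ?h => let s := reify g in let t := reify h in constr:(Pc s t)
  | id1 ?a => constr:(Pid a)
  | _ => constr:(Pv f)
  end.

(** The absence of a default branch is deliberate: failure on any other 2-cell marks it as a
    generator and ends the translation. The image under [F2] of a composite counts as one
    generator. *)
Ltac act2_eq s t u al :=
  lazymatch al with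
  | @vcomp _ _ _ _ ?m _ ?x ?y => let m' := reify m in constr:(act2_vcomp s m' t u x y)
  | id2 _ => constr:(act2_id2 s u)
  | lwhisker _ ?x =>
      lazymatch s with Pc ?s1 ?s2 => lazymatch t with Pc _ ?t2 =>
        constr:(act2_lwhisker s1 s2 t2 u x) end end
  | rwhisker _ ?x =>
      lazymatch s with Pc ?s1 ?s2 => lazymatch t with Pc ?t1 _ =>
        constr:(act2_rwhisker s1 t1 s2 u x) end end
  | lunitor _ => constr:(act2_lunitor t u)
  | linvunitor _ => constr:(act2_linvunitor s u)
  | runitor _ => constr:(act2_runitor t u)
  | rinvunitor _ => constr:(act2_rinvunitor s u)
  | lassociator _ _ _ =>
      lazymatch s with Pc ?s1 (Pc ?s2 ?s3) => constr:(act2_lassociator s1 s2 s3 u) end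
  | rassociator _ _ _ =>
      lazymatch t with Pc ?s1 (Pc ?s2 ?s3) => constr:(act2_rassociator s1 s2 s3 u) end
  end.

Ltac push_act2_goal :=
  match goal with
  | |- context [?T] =>
    lazymatch T with
    | act2 ?s ?t ?u ?al =>
      let E := act2_eq s t u al in
      let R := lazymatch type of E with _ = ?R => constr:(R) end in
      let H := fresh in
      assert (H : T = R) by exact E; cbn [act actr ev] in H; rewrite H; clear H
    end
  end.
Ltac push_act2_in K :=
  match type of K with
  | context [?T] =>
    lazymatch T with
    | act2 ?s ?t ?u ?al =>
      let E := act2_eq s t u al in
      let R := lazymatch type of E with _ = ?R => constr:(R) end in
      let H := fresh in
      assert (H : T = R) by exact E; cbn [act actr ev] in H; rewrite H in K; clear H
    end
  end.

Ltac strictify :=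
  match goal with
  | |- @eq (@cell _ _ _ ?f ?g) _ _ =>
    let s := reify f in let t := reify g in
    apply (act2_faithful (s := s) (t := t));
    let x := fresh "x" in let u := fresh "u" in intros x u;
    repeat push_act2_goal; cbn [act actr ev]; vnorm
  end.

Ltac strictify_in K u :=
  match type of K with
  | @eq (@cell _ _ _ ?f ?g) ?l ?r =>
    let s := reify f in let t := reify g in
    apply (f_equal (act2 s t u)) in K;
    repeat push_act2_in K; cbn [act actr ev] in K; vnorm_in K
  end.

(* [exchange al] moves the generator [al] to the left past the cell preceding it;
   the prefixes [w] and [ww] count the right whiskerings, as for [vrw]. *)
Ltac exchange al :=
  match goal with
  | |- context [act2 ?s ?t ?v al] =>
    vrw (fun u z => act2_exchange s t (u := u) (v := v) z al)
  end.
Ltac wexchange al :=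
  match goal with
  | |- context [act2 ?s ?t ?v al] =>
    wrw (fun u z => act2_exchange s t (u := u) (v := v) z al)
  end.
Ltac wwexchange al :=
  match goal with
  | |- context [act2 ?s ?t ?v al] =>
    wwrw (fun u z => act2_exchange s t (u := u) (v := v) z al)
  end.
Ltac wexchange_back al :=
  match goal with
  | |- context [act2 ?s ?t ?u al] =>
    wrw <- (fun v z => act2_exchange s t (u := u) (v := v) z al)
  end.
Ltac exchange_back al :=
  match goal with
  | |- context [act2 ?s ?t ?u al] =>
    vrw <- (fun v z => act2_exchange s t (u := u) (v := v) z al)
  end.

(** ** Strict forms of the axioms *)

Section PsfunctorLaws.
Context {A B : Bicat} {F : psfunctor_data A B} (HF : is_psfunctor F).

Ltac law := intros; pose proof HF as H; unfold is_psfunctor in H;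
  decompose [and] H; eauto.

Lemma F2_id2 a b (f : hom a b) : F2 F (id2 f) = id2 (F1 F f).
Proof. law. Qed.
Lemma F2_vcomp a b (f g h : hom a b) (x : cell f g) (y : cell g h) :
  F2 F (vcomp x y) = vcomp (F2 F x) (F2 F y).
Proof. law. Qed.
Lemma F_lunitor a b (f : hom a b) :
  vcomp (rwhisker (F1 F f) (Fid F a)) (vcomp (Fcomp F (id1 a) f) (F2 F (lunitor f)))
  = lunitor (F1 F f).
Proof. symmetry. rewrite <- vassoc. law. Qed.
Lemma F_runitor a b (f : hom a b) :
  vcomp (lwhisker (F1 F f) (Fid F b)) (vcomp (Fcomp F f (id1 b)) (F2 F (runitor f)))
  = runitor (F1 F f).
Proof. symmetry. rewrite <- vassoc. law. Qed.
Lemma F_lassociator a b c d (f : hom a b) (g : hom b c) (h : hom c d) :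
  vcomp (lwhisker (F1 F f) (Fcomp F g h)) (vcomp (Fcomp F f (comp1 g h))
        (F2 F (lassociator f g h)))
  = vcomp (lassociator (F1 F f) (F1 F g) (F1 F h))
      (vcomp (rwhisker (F1 F h) (Fcomp F f g)) (Fcomp F (comp1 f g) h)).
Proof. rewrite <- !vassoc. law. Qed.
Lemma F_lwhisker a b c (f : hom a b) (g1 g2 : hom b c) (x : cell g1 g2) :
  vcomp (lwhisker (F1 F f) (F2 F x)) (Fcomp F f g2)
  = vcomp (Fcomp F f g1) (F2 F (lwhisker f x)).
Proof. law. Qed.
Lemma F_rwhisker a b c (f1 f2 : hom a b) (g : hom b c) (x : cell f1 f2) :
  vcomp (rwhisker (F1 F g) (F2 F x)) (Fcomp F f2 g)
  = vcomp (Fcomp F f1 g) (F2 F (rwhisker g x)).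
Proof. law. Qed.
Lemma invertible_Fid a : is_invertible (Fid F a).
Proof. law. Qed.
Lemma invertible_Fcomp a b c (f : hom a b) (g : hom b c) : is_invertible (Fcomp F f g).
Proof. law. Qed.

Lemma F2_inverse a b (f g : hom a b) (x : cell f g) y :
  inverse_pair x y -> inverse_pair (F2 F x) (F2 F y).
Proof. intros [H1 H2]. split; now rewrite <- F2_vcomp, ?H1, ?H2, F2_id2. Qed.

Lemma invertible_F2 a b (f g : hom a b) (x : cell f g) :
  is_invertible x -> is_invertible (F2 F x).
Proof. intros [y Hy]. exists (F2 F y). now apply F2_inverse. Qed.

End PsfunctorLaws.

Section PstransLaws.
Context {A B : Bicat} {F G : psfunctor_data A B} {s : pstrans_data F G} (Hs : is_pstrans s).

Lemma invertible_psnat a b (f : hom a b) : is_invertible (psnat s f).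
Proof. apply Hs. Qed.

Lemma psnat_nat a b (f g : hom a b) (x : cell f g) y (u : hom y (F a)) :
  vcomp (act2 (Pv (F1 G f)) (Pv (F1 G g)) (comp1 u (s a)) (F2 G x))
    (act2 (Pc (Pv (s a)) (Pv (F1 G g))) (Pc (Pv (F1 F g)) (Pv (s b))) u (psnat s g))
  = vcomp (act2 (Pc (Pv (s a)) (Pv (F1 G f))) (Pc (Pv (F1 F f)) (Pv (s b))) u (psnat s f))
      (rwhisker (s b) (act2 (Pv (F1 F f)) (Pv (F1 F g)) u (F2 F x))).
Proof.
  destruct Hs as (_ & H & _). specialize (H a b f g x).
  strictify_in H u. exact H.
Qed.

Lemma psnat_id a y (u : hom y (F a)) :
  vcomp (act2 (Pid _) (Pv _) (comp1 u (s a)) (Fid G a))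
    (act2 (Pc (Pv (s a)) (Pv (F1 G (id1 a)))) (Pc (Pv (F1 F (id1 a))) (Pv (s a))) u
      (psnat s (id1 a)))
  = rwhisker (s a) (act2 (Pid _) (Pv _) u (Fid F a)).
Proof.
  destruct Hs as (_ & _ & H & _). specialize (H a).
  strictify_in H u. exact H.
Qed.

Lemma psnat_comp a b c (f : hom a b) (g : hom b c) y (u : hom y (F a)) :
  vcomp (act2 (Pc (Pv (F1 G f)) (Pv (F1 G g))) (Pv (F1 G (comp1 f g)))
      (comp1 u (s a)) (Fcomp G f g))
    (act2 (Pc (Pv (s a)) (Pv (F1 G (comp1 f g)))) (Pc (Pv (F1 F (comp1 f g))) (Pv (s c))) u
      (psnat s (comp1 f g)))
  = vcomp (rwhisker (F1 G g)
      (act2 (Pc (Pv (s a)) (Pv (F1 G f))) (Pc (Pv (F1 F f)) (Pv (s b))) u (psnat s f)))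
   (vcomp (act2 (Pc (Pv (s b)) (Pv (F1 G g))) (Pc (Pv (F1 F g)) (Pv (s c)))
      (comp1 u (F1 F f)) (psnat s g))
     (rwhisker (s c) (act2 (Pc (Pv (F1 F f)) (Pv (F1 F g))) (Pv (F1 F (comp1 f g))) u
       (Fcomp F f g)))).
Proof.
  destruct Hs as (_ & _ & _ & H). specialize (H a b c f g).
  strictify_in H u. exact H.
Qed.

(** The untranslated axioms serve where an equation must be rewritten under [F2] of a further
    pseudofunctor, which the action does not enter. *)
Lemma psnat_nat_law a b (f g : hom a b) (x : cell f g) :
  vcomp (lwhisker (s a) (F2 G x)) (psnat s g) = vcomp (psnat s f) (rwhisker (s b) (F2 F x)).
Proof. apply Hs. Qed.

Lemma psnat_id_law a :
  vcomp (lwhisker (s a) (Fid G a)) (psnat s (id1 a))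
  = vcomp (runitor (s a)) (vcomp (linvunitor (s a)) (rwhisker (s a) (Fid F a))).
Proof. rewrite <- vassoc. apply Hs. Qed.

Lemma psnat_comp_law a b c (f : hom a b) (g : hom b c) :
  vcomp (lwhisker (s a) (Fcomp G f g)) (psnat s (comp1 f g))
  = vcomp (lassociator (s a) (F1 G f) (F1 G g))
   (vcomp (rwhisker (F1 G g) (psnat s f))
   (vcomp (rassociator (F1 F f) (s b) (F1 G g))
   (vcomp (lwhisker (F1 F f) (psnat s g))
   (vcomp (lassociator (F1 F f) (F1 F g) (s c))
          (rwhisker (s c) (Fcomp F f g)))))).
Proof. rewrite <- !vassoc. apply Hs. Qed.

End PstransLaws.

Lemma is_pstrans_comp {A B : Bicat} {F G H : psfunctor_data A B}
  (s : pstrans_data F G) (t : pstrans_data G H) :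
  is_pstrans s -> is_pstrans t -> is_pstrans (comp_pstrans s t).
Proof.
  intros Hs Ht. repeat split; intros; cbn [psnat pscomp comp_pstrans].
  - pose proof (invertible_psnat Hs). pose proof (invertible_psnat Ht).
    repeat apply invertible_vcomp;
    auto using invertible_rassociator, invertible_lassociator, invertible_lwhisker,
      invertible_rwhisker.
  - strictify. vrw (psnat_nat Ht). wrw (psnat_nat Hs). reflexivity.
  - strictify. vrw (psnat_id Ht). wrw (psnat_id Hs). reflexivity.
  - strictify. vrw (psnat_comp Ht). wrw (psnat_comp Hs). exchange (psnat t g). reflexivity.
Qed.

(** ** Equivalences in a bicategory *)

(** Triangle identities are left out, which makes closure under composition and under pseudofunctors
    immediate; [equivalence_adjoint] recovers them. *)
Definition equivalence {B : Bicat} {a b : B} (f : hom a b) : Prop :=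
  exists (g : hom b a) (eta : cell (id1 a) (comp1 f g)) (eps : cell (comp1 g f) (id1 b)),
    is_invertible eta /\ is_invertible eps.

Lemma act2_inverse {B : Bicat} {a b : B} {s t : path a b} {al : cell (ev s) (ev t)} {be}
  (H : vcomp al be = id2 (ev s)) x (u : hom x a) :
  vcomp (act2 s t u al) (act2 t s u be) = id2 (act s u).
Proof. rewrite <- act2_vcomp, H. apply act2_id2. Qed.

Lemma invertible_act2 {B : Bicat} {a b : B} {s t : path a b} {al : cell (ev s) (ev t)} x
  (u : hom x a) : is_invertible al -> is_invertible (act2 s t u al).
Proof. intros [be [H1 H2]]. exists (act2 t s u be). split; now apply act2_inverse. Qed.

(** The triangle identities, stated for the action so that they can be used directly as rewriting
    rules. *)
Definition adjoint_triangles {B : Bicat} {a b : B} {f : hom a b} {g : hom b a}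
  (eta : cell (id1 a) (comp1 f g)) (eps : cell (comp1 g f) (id1 b)) : Prop :=
  (forall x (u : hom x a),
    vcomp (rwhisker f (act2 (Pid a) (Pc (Pv f) (Pv g)) u eta))
          (act2 (Pc (Pv g) (Pv f)) (Pid b) (comp1 u f) eps) = id2 (comp1 u f)) /\
  (forall x (u : hom x b),
    vcomp (act2 (Pid a) (Pc (Pv f) (Pv g)) (comp1 u g) eta)
          (rwhisker g (act2 (Pc (Pv g) (Pv f)) (Pid b) u eps)) = id2 (comp1 u g)).

(* Only the counit is corrected: [eps := g f eps0^-1 ; g eta^-1 f ; eps0]. *)
Lemma equivalence_adjoint {B : Bicat} {a b : B} (f : hom a b) :
  equivalence f ->
  exists (g : hom b a) (eta : cell (id1 a) (comp1 f g)) (eps : cell (comp1 g f) (id1 b)),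
    is_invertible eta /\ is_invertible eps /\ adjoint_triangles eta eps.
Proof.
  intros (g & eta & eps0 & Heta & Heps0).
  pose proof Heta as (eta' & E1 & E2). pose proof Heps0 as (eps0' & E3 & E4).
  assert (I0 : is_invertible eta') by (now exists eta).
  assert (I1 : is_invertible eps0') by (now exists eps0).
  set (eps := vcomp (vcomp (vcomp (vcomp (vcomp (rinvunitor (comp1 g f))
    (lwhisker (comp1 g f) eps0')) (lassociator (comp1 g f) g f))
    (rwhisker f (rassociator g f g))) (rwhisker f (vcomp (lwhisker g eta') (runitor g)))) eps0).
  assert (Ieps : is_invertible eps).
  { unfold eps. repeat apply invertible_vcomp; auto using invertible_rinvunitor,
      invertible_lwhisker, invertible_lassociator, invertible_rwhisker,
      invertible_rassociator, invertible_vcomp, invertible_runitor. }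
  assert (Eeps : forall x (u : hom x b),
    act2 (Pc (Pv g) (Pv f)) (Pid b) u eps =
    vcomp (act2 (Pid b) (Pc (Pv g) (Pv f)) (comp1 (comp1 u g) f) eps0')
     (vcomp (rwhisker f (act2 (Pc (Pv f) (Pv g)) (Pid a) (comp1 u g) eta'))
       (act2 (Pc (Pv g) (Pv f)) (Pid b) u eps0))).
  { intros x u. unfold eps. repeat push_act2_goal. cbn [act actr ev]. vnorm.
    reflexivity. }
  assert (L : forall x (u : hom x a), is_invertible (act2 (Pid a) (Pc (Pv f) (Pv g)) u eta))
    by (intros; now apply invertible_act2).
  (* The unit at [u f g] agrees with the unit at [u] whiskered by [f] and [g]: interchange equates
     them after precomposition with the unit at [u], which is invertible. *)
  assert (Hmid : forall x (u : hom x a),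
    act2 (Pid a) (Pc (Pv f) (Pv g)) (comp1 (comp1 u f) g) eta
    = rwhisker g (rwhisker f (act2 (Pid a) (Pc (Pv f) (Pv g)) u eta))).
  { intros x u. apply (inv_cancel_left (L x u)).
    exact (act2_exchange (Pid a) (Pc (Pv f) (Pv g)) (act2 (Pid a) (Pc (Pv f) (Pv g)) u eta) eta). }
  pose proof (@act2_inverse _ _ _ (Pid a) (Pc (Pv f) (Pv g)) _ _ E1) as C1.
  pose proof (@act2_inverse _ _ _ (Pc (Pv f) (Pv g)) (Pid a) _ _ E2) as C2.
  pose proof (@act2_inverse _ _ _ (Pc (Pv g) (Pv f)) (Pid b) _ _ E3) as C3.
  pose proof (@act2_inverse _ _ _ (Pid b) (Pc (Pv g) (Pv f)) _ _ E4) as C4.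
  assert (T1 : forall x (u : hom x a),
    vcomp (rwhisker f (act2 (Pid a) (Pc (Pv f) (Pv g)) u eta))
          (act2 (Pc (Pv g) (Pv f)) (Pid b) (comp1 u f) eps) = id2 (comp1 u f)).
  { intros x u. rewrite Eeps. exchange eps0'. vrw <- Hmid. wrw C1. vrw C4. reflexivity. }
  exists g, eta, eps. do 2 (split; [assumption |]). split; [exact T1 |].
  assert (T2 : forall x (u : hom x a),
    vcomp (act2 (Pid a) (Pc (Pv f) (Pv g)) (comp1 (comp1 u f) g) eta)
      (rwhisker g (act2 (Pc (Pv g) (Pv f)) (Pid b) (comp1 u f) eps))
    = id2 (comp1 (comp1 u f) g)).
  { intros x u. rewrite Hmid. wrw T1. reflexivity. }
  (* [T2] settles the second triangle at arguments of the form [u f]. A general [u] is reached from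
     [u g f] along the invertible counit: interchange carries the triangle back along it, to an
     instance of [T2]. *)
  intros x u.
  assert (I : is_invertible (rwhisker g (act2 (Pc (Pv g) (Pv f)) (Pid b) u eps)))
    by (apply invertible_rwhisker; now apply invertible_act2).
  apply (inv_cancel_left I). exchange eta.
  wrw (act2_exchange (Pc (Pv g) (Pv f)) (Pid b)
    (act2 (Pc (Pv g) (Pv f)) (Pid b) u eps) eps).
  vrw T2. reflexivity.
Qed.

(** * Inverse naturality 2-cells and mates *)

Section InversePsnat.
Context {A B : Bicat} {F G : psfunctor_data A B} {s : pstrans_data F G} (Hs : is_pstrans s).

Definition psnat_inv a b (f : hom a b) : cell (comp1 (F1 F f) (s b)) (comp1 (s a) (F1 G f)) :=
  inv (invertible_psnat Hs f).

Notation S f := (act2 (Pc (Pv (s _)) (Pv (F1 G f))) (Pc (Pv (F1 F f)) (Pv (s _)))).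
Notation S' f := (act2 (Pc (Pv (F1 F f)) (Pv (s _))) (Pc (Pv (s _)) (Pv (F1 G f)))).

Lemma psnat_vcomp_inv a b (f : hom a b) y (u : hom y (F a)) :
  vcomp (S f u (psnat s f)) (S' f u (psnat_inv f)) = id2 _.
Proof.
  apply (@act2_inverse _ _ _ (Pc (Pv (s _)) (Pv (F1 G f))) (Pc (Pv (F1 F f)) (Pv (s _)))).
  apply vcomp_inv.
Qed.

Lemma psnat_inv_vcomp a b (f : hom a b) y (u : hom y (F a)) :
  vcomp (S' f u (psnat_inv f)) (S f u (psnat s f)) = id2 _.
Proof.
  apply (@act2_inverse _ _ _ (Pc (Pv (F1 F f)) (Pv (s _))) (Pc (Pv (s _)) (Pv (F1 G f)))).
  apply inv_vcomp.
Qed.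

Lemma invertible_S a b (f : hom a b) y (u : hom y (F a)) :
  is_invertible (S f u (psnat s f)).
Proof. apply invertible_act2. apply (invertible_psnat Hs). Qed.

Lemma psnat_inv_nat a b (f g : hom a b) (x : cell f g) y (u : hom y (F a)) :
  vcomp (rwhisker (s b) (act2 (Pv (F1 F f)) (Pv (F1 F g)) u (F2 F x))) (S' g u (psnat_inv g))
  = vcomp (S' f u (psnat_inv f))
      (act2 (Pv (F1 G f)) (Pv (F1 G g)) (comp1 u (s a)) (F2 G x)).
Proof.
  apply (inv_cancel_left (invertible_S f u)). vrw psnat_vcomp_inv.
  vrw <- (psnat_nat Hs). vrw psnat_vcomp_inv. reflexivity.
Qed.

Lemma psnat_inv_id a y (u : hom y (F a)) :
  vcomp (rwhisker (s a) (act2 (Pid _) (Pv _) u (Fid F a))) (S' (id1 a) u (psnat_inv (id1 a)))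
  = act2 (Pid _) (Pv _) (comp1 u (s a)) (Fid G a).
Proof. vrw <- (psnat_id Hs). vrw psnat_vcomp_inv. reflexivity. Qed.

Lemma psnat_inv_comp a b c (f : hom a b) (g : hom b c) y (u : hom y (F a)) :
  vcomp (rwhisker (s c) (act2 (Pc (Pv (F1 F f)) (Pv (F1 F g))) (Pv (F1 F (comp1 f g))) u
       (Fcomp F f g))) (S' (comp1 f g) u (psnat_inv (comp1 f g)))
  = vcomp (S' g (comp1 u (F1 F f)) (psnat_inv g))
     (vcomp (rwhisker (F1 G g) (S' f u (psnat_inv f)))
       (act2 (Pc (Pv (F1 G f)) (Pv (F1 G g))) (Pv (F1 G (comp1 f g)))
          (comp1 u (s a)) (Fcomp G f g))).
Proof.
  apply (inv_cancel_left (invertible_S g (comp1 u (F1 F f)))).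
  apply (inv_cancel_left (invertible_rwhisker (F1 G g) (invertible_S f u))).
  vrw psnat_vcomp_inv. wrw psnat_vcomp_inv.
  vrw <- (psnat_comp Hs). vrw psnat_vcomp_inv. reflexivity.
Qed.

End InversePsnat.

Section InversePstrans.
Context {A B : Bicat} {F G : psfunctor_data A B} {s : pstrans_data F G} (Hs : is_pstrans s).
Context {t0 : forall a, hom (G a) (F a)}
  {eta : forall a, cell (id1 (F a)) (comp1 (s a) (t0 a))}
  {eps : forall a, cell (comp1 (t0 a) (s a)) (id1 (G a))}
  (Heta : forall a, is_invertible (eta a)) (Heps : forall a, is_invertible (eps a))
  (Htri : forall a, adjoint_triangles (eta a) (eps a)).

(* The mate of [psnat s f ^-1]. *)
Definition mate_pstrans : pstrans_data G F :=
  {| pscomp := t0;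
     psnat := fun a b f =>
       vcomp (rinvunitor (comp1 (t0 a) (F1 F f)))
      (vcomp (lwhisker (comp1 (t0 a) (F1 F f)) (eta b))
      (vcomp (lassociator (comp1 (t0 a) (F1 F f)) (s b) (t0 b))
      (vcomp (rwhisker (t0 b) (rassociator (t0 a) (F1 F f) (s b)))
      (vcomp (rwhisker (t0 b) (lwhisker (t0 a) (psnat_inv Hs f)))
      (vcomp (rwhisker (t0 b) (lassociator (t0 a) (s a) (F1 G f)))
             (rwhisker (t0 b) (vcomp (rwhisker (F1 G f) (eps a)) (lunitor (F1 G f))))))))) |}.

Lemma triangle1 a x (u : hom x (F a)) :
  vcomp (rwhisker (s a) (act2 (Pid _) (Pc (Pv (s a)) (Pv (t0 a))) u (eta a)))
        (act2 (Pc (Pv (t0 a)) (Pv (s a))) (Pid _) (comp1 u (s a)) (eps a))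
  = id2 (comp1 u (s a)).
Proof. apply Htri. Qed.

Lemma triangle2 a x (u : hom x (G a)) :
  vcomp (act2 (Pid _) (Pc (Pv (s a)) (Pv (t0 a))) (comp1 u (t0 a)) (eta a))
        (rwhisker (t0 a) (act2 (Pc (Pv (t0 a)) (Pv (s a))) (Pid _) u (eps a)))
  = id2 (comp1 u (t0 a)).
Proof. apply Htri. Qed.

Lemma is_pstrans_mate : is_pstrans mate_pstrans.
Proof.
  repeat split; intros; cbn [psnat pscomp mate_pstrans].
  - repeat apply invertible_vcomp; auto using invertible_rinvunitor,
      invertible_lwhisker, invertible_lassociator, invertible_rwhisker,
      invertible_rassociator, invertible_vcomp, invertible_lunitor, invertible_inv.
    apply invertible_rwhisker, invertible_lwhisker, invertible_inv.
  - strictify. exchange (eta b). wrw (psnat_inv_nat Hs).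
    wexchange (F2 G x). reflexivity.
  - strictify. exchange (eta a). wrw (psnat_inv_id Hs). wexchange_back (Fid G a).
    vrw triangle2. reflexivity.
  - strictify. exchange (eta c). wrw (psnat_inv_comp Hs). wexchange_back (Fcomp G f g).
    (* The mates at [f] and [g] contribute a unit and a counit at the intermediate object [b].
       Interchange makes the two adjacent, and the first triangle removes them. *)
    do 3 exchange (eta c). do 3 wexchange (psnat_inv Hs g). do 2 wwexchange (eps b).
    wwrw triangle1. reflexivity.
Qed.

Lemma mate_unit : is_modification (id_pstrans F) (comp_pstrans s mate_pstrans) eta.
Proof.
  intros a b f. cbn [psnat pscomp mate_pstrans id_pstrans comp_pstrans].
  strictify. exchange (eta b). wexchange (psnat_inv Hs f).
  wwrw triangle1. wrw (psnat_inv_vcomp Hs). reflexivity.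
Qed.

Lemma mate_counit : is_modification (comp_pstrans mate_pstrans s) (id_pstrans G) eps.
Proof.
  intros a b f. cbn [psnat pscomp mate_pstrans id_pstrans comp_pstrans].
  strictify. do 2 exchange (eps b). vrw triangle1. vrw (psnat_vcomp_inv Hs). reflexivity.
Qed.

End InversePstrans.

(** The square for the inverse components follows by cancelling [m a] and [m b] from the square for
    [m]. *)
Lemma invertible_modification {A B : Bicat} {F G : psfunctor_data A B}
  (s t : pstrans_data F G) (m : forall a, cell (s a) (t a)) :
  is_modification s t m -> (forall a, is_invertible (m a)) ->
  is_invertible_modification s t m.
Proof.
  intros Hm Hi. split; [exact Hm |]. exists (fun a => inv (Hi a)). split; [| split].
  - intros a b f.
    apply (inv_cancel_left (invertible_rwhisker (F1 G f) (Hi a))).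
    apply (inv_cancel_right (invertible_lwhisker (F1 F f) (Hi b))).
    rewrite <- !vassoc, <- rwhisker_vcomp, vcomp_inv, id2_rwhisker, id2_left.
    rewrite vassoc, vassoc, <- lwhisker_vcomp, inv_vcomp, lwhisker_id2, id2_right.
    symmetry. apply Hm.
  - intros a. apply vcomp_inv.
  - intros a. apply inv_vcomp.
Qed.

(** * Equivalence of pseudofunctors tested on components *)

Definition equivalence_transformation {A B : Bicat} (F G : psfunctor_data A B) : Prop :=
  exists s : pstrans_data F G, is_pstrans s /\ forall a, equivalence (s a).

Lemma equivalent_of_transformation {A B : Bicat} (F G : psfunctor_data A B) :
  equivalence_transformation F G -> equivalent_in_functor_bicat F G.
Proof.
  intros (s & Hs & He).
  (* Inverse, unit and counit are bundled so that one choice for each object yields all three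
     together with their triangle identities. *)
  pose (P := fun a (q : {g : hom (G a) (F a) & cell (id1 (F a)) (comp1 (s a) g)
    * cell (comp1 g (s a)) (id1 (G a))}%type) =>
    is_invertible (fst (projT2 q)) /\ is_invertible (snd (projT2 q)) /\
    adjoint_triangles (fst (projT2 q)) (snd (projT2 q))).
  assert (Hex : forall a, exists q, P a q).
  { intros a. destruct (equivalence_adjoint (He a)) as (g & eta & eps & H).
    exists (existT _ g (eta, eps)). exact H. }
  pose (q := fun a => proj1_sig (constructive_indefinite_description _ (Hex a))).
  assert (Hq : forall a, P a (q a))
    by (intros a; exact (proj2_sig (constructive_indefinite_description _ (Hex a)))).
  pose (eta := fun a => fst (projT2 (q a))). pose (eps := fun a => snd (projT2 (q a))).
  assert (Htri : forall a, adjoint_triangles (eta a) (eps a)) by (intros a; apply (Hq a)).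
  exists s, (@mate_pstrans _ _ _ _ s Hs (fun a => projT1 (q a)) eta eps).
  split; [exact Hs |]. split.
  { apply is_pstrans_mate; [intros a; apply (Hq a) .. | exact Htri]. }
  split.
  - exists eta. apply invertible_modification; [now apply mate_unit | intros a; apply (Hq a)].
  - exists eps. apply invertible_modification; [now apply mate_counit | intros a; apply (Hq a)].
Qed.

Lemma transformation_of_equivalent {A B : Bicat} (F G : psfunctor_data A B) :
  equivalent_in_functor_bicat F G -> equivalence_transformation F G.
Proof.
  intros (s & t & Hs & Ht & (eta & _ & eta' & _ & E1 & E2) & (eps & _ & eps' & _ & E3 & E4)).
  exists s. split; [exact Hs |]. intros a. exists (t a), (eta a), (eps a).
  split; [exists (eta' a) | exists (eps' a)]; auto.
Qed.

Lemma equivalence_id {B : Bicat} (a : B) : equivalence (id1 a).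
Proof.
  exists (id1 a), (linvunitor _), (lunitor _).
  split; [apply invertible_linvunitor | apply invertible_lunitor].
Qed.

(** Only units are constructed. The counit is the inverse of the unit for the reversed composite,
    whose ingredients are the inverted counits of the factors. *)
Lemma equivalence_comp {B : Bicat} (a b c : B) (f : hom a b) (g : hom b c) :
  equivalence f -> equivalence g -> equivalence (comp1 f g).
Proof.
  assert (unit : forall (x y z : B) (p : hom x y) (q : hom y z) (p' : hom y x) (q' : hom z y)
    (e : cell (id1 x) (comp1 p p')) (e' : cell (id1 y) (comp1 q q')),
    is_invertible e -> is_invertible e' ->
    exists d : cell (id1 x) (comp1 (comp1 p q) (comp1 q' p')), is_invertible d).
  { intros. exists (vcomp e (vcomp (rwhisker p' (vcomp (rinvunitor p) (lwhisker p e')))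
      (vcomp (rwhisker p' (lassociator p q q')) (rassociator (comp1 p q) q' p')))).
    auto 10 using invertible_vcomp, invertible_rwhisker, invertible_rinvunitor,
      invertible_lwhisker, invertible_lassociator, invertible_rassociator. }
  intros (f' & eta & eps & H1 & H2) (g' & eta' & eps' & H3 & H4).
  destruct (unit _ _ _ f g f' g' eta eta' H1 H3) as [d Hd].
  destruct (unit _ _ _ g' f' g f (inv H4) (inv H2)) as [k Hk]; try apply invertible_inv.
  exists (comp1 g' f'), d, (inv Hk). split; [exact Hd | apply invertible_inv].
Qed.

Lemma equivalence_F1 {A B : Bicat} {F : psfunctor_data A B} (HF : is_psfunctor F) (a b : A)
  (f : hom a b) : equivalence f -> equivalence (F1 F f).
Proof.
  intros (g & eta & eps & H1 & H2).
  exists (F1 F g), (vcomp (Fid F a) (vcomp (F2 F eta) (inv (invertible_Fcomp HF f g)))),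
    (vcomp (Fcomp F g f) (vcomp (F2 F eps) (inv (invertible_Fid HF b)))).
  pose proof (invertible_Fid HF). pose proof (invertible_Fcomp HF).
  pose proof (invertible_F2 HF).
  split; repeat apply invertible_vcomp; auto using invertible_inv.
Qed.

Lemma equivalence_transformation_trans {A B : Bicat} (F G H : psfunctor_data A B) :
  equivalence_transformation F G -> equivalence_transformation G H ->
  equivalence_transformation F H.
Proof.
  intros (s & Hs & Es) (t & Ht & Et). exists (comp_pstrans s t).
  split; [now apply is_pstrans_comp | intros a; now apply equivalence_comp].
Qed.

(** ** Composition of pseudofunctors *)

Section StrictPsfunctorLaws.
Context {A B : Bicat} {F : psfunctor_data A B} (HF : is_psfunctor F).

Notation C f g := (act2 (Pc (Pv (F1 F f)) (Pv (F1 F g))) (Pv (F1 F (comp1 f g)))).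
Notation C' f g := (act2 (Pv (F1 F (comp1 f g))) (Pc (Pv (F1 F f)) (Pv (F1 F g)))).
Notation V f g := (act2 (Pv (F1 F f)) (Pv (F1 F g))).

Definition Fcomp_inv a b c (f : hom a b) (g : hom b c) :
  cell (F1 F (comp1 f g)) (comp1 (F1 F f) (F1 F g)) := inv (invertible_Fcomp HF f g).

Definition Fid_inv a : cell (F1 F (id1 a)) (id1 (F a)) := inv (invertible_Fid HF a).

Lemma Fcomp_vcomp_inv a b c (f : hom a b) (g : hom b c) y (u : hom y (F a)) :
  vcomp (C f g u (Fcomp F f g)) (C' f g u (Fcomp_inv f g)) = id2 _.
Proof.
  apply (@act2_inverse _ _ _ (Pc (Pv (F1 F f)) (Pv (F1 F g))) (Pv (F1 F (comp1 f g)))).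
  apply vcomp_inv.
Qed.

Lemma Fcomp_inv_vcomp a b c (f : hom a b) (g : hom b c) y (u : hom y (F a)) :
  vcomp (C' f g u (Fcomp_inv f g)) (C f g u (Fcomp F f g)) = id2 _.
Proof.
  apply (@act2_inverse _ _ _ (Pv (F1 F (comp1 f g))) (Pc (Pv (F1 F f)) (Pv (F1 F g)))).
  apply inv_vcomp.
Qed.

Lemma Fid_vcomp_inv a y (u : hom y (F a)) :
  vcomp (act2 (Pid _) (Pv _) u (Fid F a)) (act2 (Pv _) (Pid _) u (Fid_inv a)) = id2 _.
Proof. apply (@act2_inverse _ _ _ (Pid _) (Pv _)). apply vcomp_inv. Qed.

Lemma Fcomp_lwhisker a b c (f : hom a b) (g1 g2 : hom b c) (x : cell g1 g2) y (u : hom y (F a)) :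
  vcomp (V g1 g2 (comp1 u (F1 F f)) (F2 F x)) (C f g2 u (Fcomp F f g2))
  = vcomp (C f g1 u (Fcomp F f g1)) (V (comp1 f g1) (comp1 f g2) u (F2 F (lwhisker f x))).
Proof. pose proof (F_lwhisker HF f x) as H. strictify_in H u. exact H. Qed.

Lemma Fcomp_rwhisker a b c (f1 f2 : hom a b) (g : hom b c) (x : cell f1 f2) y (u : hom y (F a)) :
  vcomp (rwhisker (F1 F g) (V f1 f2 u (F2 F x))) (C f2 g u (Fcomp F f2 g))
  = vcomp (C f1 g u (Fcomp F f1 g)) (V (comp1 f1 g) (comp1 f2 g) u (F2 F (rwhisker g x))).
Proof. pose proof (F_rwhisker HF g x) as H. strictify_in H u. exact H. Qed.

Lemma Fcomp_lassociator a b c d (f : hom a b) (g : hom b c) (h : hom c d) y (u : hom y (F a)) :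
  vcomp (C g h (comp1 u (F1 F f)) (Fcomp F g h))
   (vcomp (C f (comp1 g h) u (Fcomp F f (comp1 g h)))
     (V (comp1 f (comp1 g h)) (comp1 (comp1 f g) h) u (F2 F (lassociator f g h))))
  = vcomp (rwhisker (F1 F h) (C f g u (Fcomp F f g)))
      (C (comp1 f g) h u (Fcomp F (comp1 f g) h)).
Proof. pose proof (F_lassociator HF f g h) as H. strictify_in H u. exact H. Qed.

Lemma Fid_lunitor a b (f : hom a b) y (u : hom y (F a)) :
  vcomp (rwhisker (F1 F f) (act2 (Pid _) (Pv _) u (Fid F a)))
   (vcomp (C (id1 a) f u (Fcomp F (id1 a) f)) (V (comp1 (id1 a) f) f u (F2 F (lunitor f))))
  = id2 (comp1 u (F1 F f)).
Proof. pose proof (F_lunitor HF f) as H. strictify_in H u. exact H. Qed.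

Lemma Fid_runitor a b (f : hom a b) y (u : hom y (F a)) :
  vcomp (act2 (Pid _) (Pv _) (comp1 u (F1 F f)) (Fid F b))
   (vcomp (C f (id1 b) u (Fcomp F f (id1 b))) (V (comp1 f (id1 b)) f u (F2 F (runitor f))))
  = id2 (comp1 u (F1 F f)).
Proof. pose proof (F_runitor HF f) as H. strictify_in H u. exact H. Qed.

(** Since [F2] of a composite is a single generator, this rule splits it. Used backwards it collects
    images under [F2], so that an equation of the source bicategory can be applied inside. *)
Lemma act2_F2_vcomp a b (f g h : hom a b) (x : cell f g) (z : cell g h) y (u : hom y (F a)) :
  V f h u (F2 F (vcomp x z)) = vcomp (V f g u (F2 F x)) (V g h u (F2 F z)).
Proof. rewrite (F2_vcomp HF). apply (act2_vcomp (Pv _) (Pv _) (Pv _)). Qed.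

Lemma act2_F2_id2 a b (f : hom a b) y (u : hom y (F a)) :
  V f f u (F2 F (id2 f)) = id2 _.
Proof. rewrite (F2_id2 HF). apply (act2_id2 (Pv _)). Qed.

Lemma invertible_C a b c (f : hom a b) (g : hom b c) y (u : hom y (F a)) :
  is_invertible (C f g u (Fcomp F f g)).
Proof. apply invertible_act2, HF. Qed.

Lemma Fcomp_inv_rwhisker a b c (f1 f2 : hom a b) (g : hom b c) (x : cell f1 f2) y
  (u : hom y (F a)) :
  vcomp (V (comp1 f1 g) (comp1 f2 g) u (F2 F (rwhisker g x))) (C' f2 g u (Fcomp_inv f2 g))
  = vcomp (C' f1 g u (Fcomp_inv f1 g)) (rwhisker (F1 F g) (V f1 f2 u (F2 F x))).
Proof.
  apply (inv_cancel_left (invertible_C f1 g u)).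
  vrw <- Fcomp_rwhisker. vrw Fcomp_vcomp_inv. vrw Fcomp_vcomp_inv. reflexivity.
Qed.

Lemma Fcomp_inv_lassociator a b c d (f : hom a b) (g : hom b c) (h : hom c d) y
  (u : hom y (F a)) :
  vcomp (C f (comp1 g h) u (Fcomp F f (comp1 g h)))
     (V (comp1 f (comp1 g h)) (comp1 (comp1 f g) h) u (F2 F (lassociator f g h)))
  = vcomp (C' g h (comp1 u (F1 F f)) (Fcomp_inv g h))
   (vcomp (rwhisker (F1 F h) (C f g u (Fcomp F f g)))
      (C (comp1 f g) h u (Fcomp F (comp1 f g) h))).
Proof. vrw <- Fcomp_lassociator. vrw Fcomp_inv_vcomp. reflexivity. Qed.

Lemma Fcomp_inv_rassociator a b c d (f : hom a b) (g : hom b c) (h : hom c d) y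
  (u : hom y (F a)) :
  vcomp (C (comp1 f g) h u (Fcomp F (comp1 f g) h))
     (V (comp1 (comp1 f g) h) (comp1 f (comp1 g h)) u (F2 F (rassociator f g h)))
  = vcomp (rwhisker (F1 F h) (C' f g u (Fcomp_inv f g)))
   (vcomp (C g h (comp1 u (F1 F f)) (Fcomp F g h))
          (C f (comp1 g h) u (Fcomp F f (comp1 g h)))).
Proof.
  apply (inv_cancel_left (invertible_rwhisker (F1 F h) (invertible_C f g u))).
  wrw Fcomp_vcomp_inv. vrw <- Fcomp_lassociator. vrw <- act2_F2_vcomp.
  rewrite lassociator_rassociator, act2_F2_id2. vnorm. reflexivity.
Qed.

Lemma Fid_linvunitor a b (f : hom a b) y (u : hom y (F a)) :
  vcomp (V f (comp1 (id1 a) f) u (F2 F (linvunitor f)))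
        (C' (id1 a) f u (Fcomp_inv (id1 a) f))
  = rwhisker (F1 F f) (act2 (Pid _) (Pv _) u (Fid F a)).
Proof.
  assert (I : is_invertible (vcomp (C (id1 a) f u (Fcomp F (id1 a) f))
      (V (comp1 (id1 a) f) f u (F2 F (lunitor f))))).
  { apply invertible_vcomp; [apply invertible_C |].
    apply invertible_act2, (invertible_F2 HF), invertible_lunitor. }
  apply (inv_cancel_right I). rewrite !vassoc. vrw Fcomp_inv_vcomp. vrw <- act2_F2_vcomp.
  rewrite linvunitor_lunitor, act2_F2_id2. vrw Fid_lunitor. reflexivity.
Qed.

End StrictPsfunctorLaws.

(** For each coherence axiom, naturality of the compositor of [G] gathers all images under [F2 G]
    into one; the axiom of [F] is applied inside it and the corresponding axiom or naturality of [G]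
    outside. *)
Lemma is_psfunctor_comp {A B C : Bicat} (F : psfunctor_data A B) (G : psfunctor_data B C) :
  is_psfunctor F -> is_psfunctor G -> is_psfunctor (comp_psfunctor F G).
Proof.
  intros HF HG. repeat split; intros; cbn [F0 F1 F2 Fid Fcomp comp_psfunctor].
  - now rewrite (F2_id2 HF), (F2_id2 HG).
  - now rewrite (F2_vcomp HF), (F2_vcomp HG).
  - strictify. vrw (Fcomp_rwhisker HG). repeat vrw <- (act2_F2_vcomp HG).
    rewrite (F_lunitor HF). vrw (Fid_lunitor HG). reflexivity.
  - strictify. vrw (Fcomp_lwhisker HG). repeat vrw <- (act2_F2_vcomp HG).
    rewrite (F_runitor HF). vrw (Fid_runitor HG). reflexivity.
  - strictify. vrw (Fcomp_lwhisker HG). vrw (Fcomp_rwhisker HG).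
    vrw <- (Fcomp_lassociator HG). repeat vrw <- (act2_F2_vcomp HG).
    rewrite (F_lassociator HF). reflexivity.
  - strictify. vrw (Fcomp_lwhisker HG). repeat vrw <- (act2_F2_vcomp HG).
    rewrite (F_lwhisker HF). reflexivity.
  - strictify. vrw (Fcomp_rwhisker HG). repeat vrw <- (act2_F2_vcomp HG).
    rewrite (F_rwhisker HF). reflexivity.
  - apply invertible_vcomp; [apply HG | apply (invertible_F2 HG), HF].
  - apply invertible_vcomp; [apply HG | apply (invertible_F2 HG), HF].
Qed.

(** * Whiskering of transformations by pseudofunctors *)

Definition precomp_pstrans {A B C : Bicat} (U : psfunctor_data A B) {F G : psfunctor_data B C}
  (s : pstrans_data F G) : pstrans_data (comp_psfunctor U F) (comp_psfunctor U G) :=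
  @Build_pstrans_data _ _ (comp_psfunctor U F) (comp_psfunctor U G)
    (fun a => s (U a)) (fun a b f => psnat s (F1 U f)).

(** The coherence 2-cells of [U] occur as arguments of [F2] and pass through [s] by its naturality
    in 2-cells. *)
Lemma is_pstrans_precomp {A B C : Bicat} (U : psfunctor_data A B) {F G : psfunctor_data B C}
  (s : pstrans_data F G) : is_pstrans s -> is_pstrans (precomp_pstrans U s).
Proof.
  intros Hs. repeat split; intros; cbn [F0 F1 F2 Fid Fcomp comp_psfunctor psnat pscomp
    precomp_pstrans].
  - apply (invertible_psnat Hs).
  - apply Hs.
  - strictify. vrw (psnat_nat Hs). vrw (psnat_id Hs). reflexivity.
  - strictify. vrw (psnat_nat Hs). vrw (psnat_comp Hs). reflexivity.
Qed.

Section Postcomp.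
Context {A B C : Bicat} {F G : psfunctor_data A B} {V : psfunctor_data B C}
  (HV : is_psfunctor V) {s : pstrans_data F G} (Hs : is_pstrans s).

(** [V] sends a naturality square to one between images of composites; the compositor and its
    inverse turn these into composites of images. *)
Definition postcomp_pstrans : pstrans_data (comp_psfunctor F V) (comp_psfunctor G V) :=
  @Build_pstrans_data _ _ (comp_psfunctor F V) (comp_psfunctor G V)
    (fun a => F1 V (s a))
    (fun a b f => vcomp (Fcomp V (s a) (F1 G f))
      (vcomp (F2 V (psnat s f)) (Fcomp_inv HV (F1 F f) (s b)))).

Lemma is_pstrans_postcomp : is_pstrans postcomp_pstrans.
Proof.
  repeat split; intros; cbn [F0 F1 F2 Fid Fcomp comp_psfunctor psnat pscomp postcomp_pstrans].
  - repeat apply invertible_vcomp; [apply HV | apply (invertible_F2 HV), Hs | apply invertible_inv].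
  - strictify. vrw (Fcomp_lwhisker HV). vrw <- (act2_F2_vcomp HV).
    rewrite (psnat_nat_law Hs x). vrw (act2_F2_vcomp HV). vrw (Fcomp_inv_rwhisker HV).
    reflexivity.
  - strictify. vrw (Fcomp_lwhisker HV). vrw <- (act2_F2_vcomp HV).
    rewrite (psnat_id_law Hs). repeat vrw (act2_F2_vcomp HV). vrw (Fid_runitor HV).
    vrw (Fcomp_inv_rwhisker HV). vrw (Fid_linvunitor HV). reflexivity.
  - strictify. vrw (Fcomp_lwhisker HV). vrw <- (act2_F2_vcomp HV).
    rewrite (psnat_comp_law Hs). repeat vrw (act2_F2_vcomp HV).
    vrw (Fcomp_lassociator HV). vrw <- (Fcomp_rwhisker HV).
    vrw (Fcomp_inv_rassociator HV). vrw <- (Fcomp_lwhisker HV).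
    vrw (Fcomp_inv_lassociator HV). vrw <- (Fcomp_rwhisker HV).
    vrw (Fcomp_vcomp_inv HV). reflexivity.
Qed.
End Postcomp.

Lemma equivalence_transformation_precomp {A B C : Bicat} (U : psfunctor_data A B)
  (F G : psfunctor_data B C) :
  equivalence_transformation F G ->
  equivalence_transformation (comp_psfunctor U F) (comp_psfunctor U G).
Proof.
  intros (s & Hs & Es). exists (precomp_pstrans U s).
  split; [now apply is_pstrans_precomp | intros a; apply Es].
Qed.

Lemma equivalence_transformation_postcomp {A B C : Bicat} (F G : psfunctor_data A B)
  (V : psfunctor_data B C) : is_psfunctor V ->
  equivalence_transformation F G ->
  equivalence_transformation (comp_psfunctor F V) (comp_psfunctor G V).
Proof.
  intros HV (s & Hs & Es). exists (postcomp_pstrans (s := s) HV).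
  split; [now apply is_pstrans_postcomp | intros a; apply (equivalence_F1 HV), Es].
Qed.

(** * Equalities between composite pseudofunctors and transitivity of biequivalence *)

(** Composites differing by bracketing or by identity factors have convertible actions on objects,
    1-cells and 2-cells. Only their coherence 2-cells differ, and these have the same types, so no
    transport arises. *)
Lemma psfunctor_data_eq {A B : Bicat} (F : psfunctor_data A B) i c :
  (forall a, Fid F a = i a) ->
  (forall a b d (f : hom a b) (g : hom b d), Fcomp F f g = c a b d f g) ->
  F = {| F0 := F0 F; F1 := @F1 _ _ F; F2 := @F2 _ _ F; Fid := i; Fcomp := c |}.
Proof.
  destruct F as [F0 F1 F2 Fid Fcomp]; simpl; intros Hi Hc. f_equal.
  - extensionality a. apply Hi.
  - extensionality a. extensionality b. extensionality d. extensionality f.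
    extensionality g. apply Hc.
Qed.

Lemma comp_psfunctor_assoc {A B C D : Bicat} (F : psfunctor_data A B)
  (G : psfunctor_data B C) (H : psfunctor_data C D) : is_psfunctor H ->
  comp_psfunctor (comp_psfunctor F G) H = comp_psfunctor F (comp_psfunctor G H).
Proof.
  intros HH. apply psfunctor_data_eq; intros; cbn [F0 F1 F2 Fid Fcomp comp_psfunctor];
  now rewrite (F2_vcomp HH), vassoc.
Qed.

Lemma comp_id_psfunctor {A B : Bicat} (F : psfunctor_data A B) : is_psfunctor F ->
  comp_psfunctor (id_psfunctor A) F = F.
Proof.
  intros HF. symmetry.
  apply (psfunctor_data_eq (F := F)); intros; cbn [F0 F1 F2 Fid Fcomp comp_psfunctor id_psfunctor];
  now rewrite (F2_id2 HF), id2_right.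
Qed.

Lemma comp_psfunctor_id {A B : Bicat} (F : psfunctor_data A B) :
  comp_psfunctor F (id_psfunctor B) = F.
Proof.
  symmetry.
  apply (psfunctor_data_eq (F := F)); intros; cbn [F0 F1 F2 Fid Fcomp comp_psfunctor id_psfunctor];
  now rewrite id2_left.
Qed.

Lemma biequivalentE (A B : Bicat) :
  biequivalent A B <->
  exists (F : psfunctor_data A B) (G : psfunctor_data B A),
    is_psfunctor F /\ is_psfunctor G /\
    equivalence_transformation (comp_psfunctor F G) (id_psfunctor A) /\
    equivalence_transformation (comp_psfunctor G F) (id_psfunctor B).
Proof.
  split.
  - intros (F & G & H1 & H2). exists F, G.
    split; [apply F | split; [apply G |]]. split; now apply transformation_of_equivalent.
  - intros (F & G & HF & HG & H1 & H2). exists (Build_psfunctor _ _ F HF),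
      (Build_psfunctor _ _ G HG).
    split; now apply equivalent_of_transformation.
Qed.

Lemma biequivalent_sym (A B : Bicat) : biequivalent A B -> biequivalent B A.
Proof. intros (F & G & H1 & H2). exists G, F. now split. Qed.

(** The middle pair [F' G'] is contracted first, then [F G]. Transitivity uses this once for each
    composite, with the two biequivalences interchanged the second time. *)
Lemma comp_retraction {A B C : Bicat} (F : psfunctor_data A B) (G : psfunctor_data B A)
  (F' : psfunctor_data B C) (G' : psfunctor_data C B) :
  is_psfunctor F -> is_psfunctor G -> is_psfunctor F' -> is_psfunctor G' ->
  equivalence_transformation (comp_psfunctor F G) (id_psfunctor A) ->
  equivalence_transformation (comp_psfunctor F' G') (id_psfunctor B) ->
  equivalence_transformation
    (comp_psfunctor (comp_psfunctor F F') (comp_psfunctor G' G)) (id_psfunctor A).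
Proof.
  intros HF HG HF' HG' H1 H2. apply equivalence_transformation_trans with (2 := H1).
  rewrite comp_psfunctor_assoc, <- (@comp_psfunctor_assoc _ _ _ _ F' G')
    by auto using is_psfunctor_comp.
  apply equivalence_transformation_precomp.
  (* Inserting an identity before [G] exhibits the goal as an instance of postcomposition with
     [G]. *)
  rewrite <- (@comp_id_psfunctor _ _ G HG) at 2.
  now apply equivalence_transformation_postcomp.
Qed.

Lemma biequivalent_trans (A B C : Bicat) :
  biequivalent A B -> biequivalent B C -> biequivalent A C.
Proof.
  rewrite !biequivalentE.
  intros (F & G & HF & HG & H1 & H2) (F' & G' & HF' & HG' & H3 & H4).
  exists (comp_psfunctor F F'), (comp_psfunctor G' G).
  split; [| split; [| split]]; auto using is_psfunctor_comp, comp_retraction.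
Qed.

(** ** Surjective equivalences are biequivalences *)

Lemma is_psfunctor_id (A : Bicat) : is_psfunctor (id_psfunctor A).
Proof.
  repeat split; intros; cbn [F0 F1 F2 Fid Fcomp id_psfunctor];
  rewrite ?lwhisker_id2, ?id2_rwhisker, ?id2_left, ?id2_right; auto using invertible_id2.
Qed.

(** * Icons: transformations with identity components *)

Section Icon.
Context {A B : Bicat} (F : psfunctor_data A B)
  (G1 : forall {a b : A}, hom a b -> hom (F a) (F b))
  (G2 : forall {a b : A} {f g : hom a b}, cell f g -> cell (G1 f) (G1 g))
  (Gid : forall a, cell (id1 (F a)) (G1 (id1 a)))
  (Gcomp : forall {a b c : A} (f : hom a b) (g : hom b c),
     cell (comp1 (G1 f) (G1 g)) (G1 (comp1 f g)))
  (tau : forall {a b : A} (f : hom a b), cell (G1 f) (F1 F f)).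

(** The target is given by its pieces over the object map of [F], so the components [id1 (F a)] are
    well typed without transport. The hypotheses are the icon axioms, in which no unitors occur;
    conjugating [tau] by unitors gives the naturality 2-cells. *)
Lemma icon_transformation :
  (forall a b (f : hom a b), is_invertible (tau f)) ->
  (forall a b (f g : hom a b) (x : cell f g), vcomp (G2 x) (tau g) = vcomp (tau f) (F2 F x)) ->
  (forall a, vcomp (Gid a) (tau (id1 a)) = Fid F a) ->
  (forall a b c (f : hom a b) (g : hom b c),
    vcomp (Gcomp f g) (tau (comp1 f g))
    = vcomp (rwhisker (G1 g) (tau f)) (vcomp (lwhisker (F1 F f) (tau g)) (Fcomp F f g))) ->
  equivalence_transformation F
    {| F0 := F0 F; F1 := @G1; F2 := @G2; Fid := Gid; Fcomp := @Gcomp |}.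
Proof.
  intros Hinv Hnat Hid Hcomp.
  set (G := {| F0 := F0 F; F1 := @G1; F2 := @G2; Fid := Gid; Fcomp := @Gcomp |}).
  exists (@Build_pstrans_data _ _ F G (fun a => id1 (F a))
    (fun a b f => vcomp (lunitor (G1 f)) (vcomp (tau f) (rinvunitor (F1 F f))))).
  split; [| intros a; apply equivalence_id].
  repeat split; intros; cbn [pscomp psnat F0 F1 F2 Fid Fcomp G].
  - repeat apply invertible_vcomp; auto using invertible_lunitor, invertible_rinvunitor.
  - pose proof (Hnat _ _ _ _ x) as H. strictify. strictify_in H u. exact H.
  - pose proof (Hid a) as H. strictify. strictify_in H u. exact H.
  - pose proof (Hcomp _ _ _ f g) as H. strictify. strictify_in H u. exact H.
Qed.
End Icon.

Lemma equivalence_transformation_refl {A B : Bicat} (F : psfunctor_data A B) :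
  is_psfunctor F -> equivalence_transformation F F.
Proof.
  intros HF. pose proof (icon_transformation (F := F) (tau := fun a b f => id2 (F1 F f))
    (G2 := @F2 _ _ F) (Gid := Fid F) (Gcomp := @Fcomp _ _ F)) as H.
  destruct F; apply H; intros; rewrite ?id2_right, ?id2_left, ?lwhisker_id2, ?id2_rwhisker,
    ?id2_left; auto using invertible_id2.
Qed.

(** * Hom categories pulled back along a map of objects *)

Definition pull_data (A : bicat_data) (O : Type) (p : O -> A) : bicat_data :=
  {| ob := O;
     hom := fun x y => hom (p x) (p y);
     cell := fun x y f g => @cell A (p x) (p y) f g;
     id1 := fun x => id1 (p x);
     comp1 := fun x y z f g => @comp1 A (p x) (p y) (p z) f g;
     id2 := fun x y f => @id2 A (p x) (p y) f;
     vcomp := fun x y f g h => @vcomp A (p x) (p y) f g h;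
     lwhisker := fun x y z f g h => @lwhisker A (p x) (p y) (p z) f g h;
     rwhisker := fun x y z f g h => @rwhisker A (p x) (p y) (p z) f g h;
     lunitor := fun x y f => @lunitor A (p x) (p y) f;
     linvunitor := fun x y f => @linvunitor A (p x) (p y) f;
     runitor := fun x y f => @runitor A (p x) (p y) f;
     rinvunitor := fun x y f => @rinvunitor A (p x) (p y) f;
     lassociator := fun x y z w f g h => @lassociator A (p x) (p y) (p z) (p w) f g h;
     rassociator := fun x y z w f g h => @rassociator A (p x) (p y) (p z) (p w) f g h |}.

Lemma is_bicat_pull (A : Bicat) (O : Type) (p : O -> A) : is_bicat (pull_data p).
Proof.
  pose proof (bicat_laws A) as H. unfold is_bicat in H. decompose [and] H; clear H.
  unfold is_bicat, pull_data; cbn. repeat match goal with |- _ /\ _ => split end; intros; auto.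
Qed.

Definition pull (A : Bicat) (O : Type) (p : O -> A) : Bicat :=
  {| bicat_data_of := pull_data p; bicat_laws := is_bicat_pull p |}.

Section PullSurjective.
Context (A : Bicat) (O : Type) (p : O -> A).

Definition pull_incl : psfunctor_data (pull p) A :=
  @Build_psfunctor_data (pull p) A p (fun x y f => f) (fun x y f g al => al)
    (fun x => id2 (id1 (p x))) (fun x y z f g => id2 (@comp1 A (p x) (p y) (p z) f g)).

Lemma is_psfunctor_pull_incl : is_psfunctor pull_incl.
Proof.
  repeat split; intros; cbn;
  rewrite ?lwhisker_id2, ?id2_rwhisker, ?id2_left, ?id2_right; auto using invertible_id2.
Qed.

(* Only pointwise equalities [r a = a] are available; function extensionality turns them into
   [r = id], so no transport of 1-cells is ever needed. *)
Lemma psfunctor_on_objects (r : A -> A) : (forall a, r a = a) ->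
  exists (T1 : forall a b : A, hom a b -> hom (r a) (r b))
    (T2 : forall (a b : A) (f g : hom a b), cell f g -> cell (T1 a b f) (T1 a b g))
    (Tid : forall a, cell (id1 (r a)) (T1 a a (id1 a)))
    (Tcomp : forall (a b c : A) (f : hom a b) (g : hom b c),
       cell (comp1 (T1 a b f) (T1 b c g)) (T1 a c (comp1 f g))),
    is_psfunctor (Build_psfunctor_data A A r T1 T2 Tid Tcomp) /\
    equivalence_transformation (Build_psfunctor_data A A r T1 T2 Tid Tcomp) (id_psfunctor A).
Proof.
  intros Hr. assert (E : r = fun a => a) by (extensionality a; apply Hr). subst r.
  exists (fun a b f => f), (fun a b f g x => x), (fun a => id2 (id1 a)),
    (fun a b c f g => id2 (comp1 f g)).
  split; [apply is_psfunctor_id | apply equivalence_transformation_refl, is_psfunctor_id].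
Qed.

Lemma biequivalent_pull : (forall a, exists x, p x = a) -> biequivalent (pull p) A.
Proof.
  intros Hp. rewrite biequivalentE.
  pose (s := fun a => proj1_sig (constructive_indefinite_description _ (Hp a))).
  assert (Hs : forall a, p (s a) = a)
    by (intros a; exact (proj2_sig (constructive_indefinite_description _ (Hp a)))).
  destruct (psfunctor_on_objects Hs) as (T1 & T2 & Tid & Tcomp & HD & E).
  set (D := Build_psfunctor_data _ _ _ T1 T2 Tid Tcomp) in *.
  (* A 1-cell of [pull p] from [s a] to [s b] is one of [A] from [p (s a)] to [p (s b)], so the data
     of [D] can be reread as a pseudofunctor into [pull p], and [HD] proves its laws. *)
  pose (T := @Build_psfunctor_data A (pull p) s T1 T2 Tid Tcomp).
  exists pull_incl, T. split; [apply is_psfunctor_pull_incl |]. split; [exact HD |].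
  split.
  (* Restricting [E] along [pull_incl] gives a transformation between functors into [A]; its cells
     are also cells of [pull p], hence the same data gives the required transformation there. *)
  - apply (equivalence_transformation_precomp pull_incl) in E.
    rewrite comp_psfunctor_id in E. destruct E as (t & Ht & Et).
    exists (@Build_pstrans_data (pull p) (pull p) (comp_psfunctor pull_incl T)
      (id_psfunctor (pull p)) (fun a => t a) (fun a b f => psnat t f)).
    split; [exact Ht | exact Et].
  - replace (comp_psfunctor T pull_incl) with D; [exact E |].
    symmetry. apply (psfunctor_data_eq (F := comp_psfunctor T pull_incl)); intros;
    apply (id2_left (B := A)).
Qed.
End PullSurjective.

(** * Inverting a local equivalence that fixes objects *)

Definition local_equivalence {C A : Bicat} (P : psfunctor_data C A) : Prop :=
  forall a a' : C,
    (forall g : hom (P a) (P a'), exists (f : hom a a') (x : cell (F1 P f) g), is_invertible x) /\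
    (forall (f f' : hom a a') (y : cell (F1 P f) (F1 P f')), exists x, F2 P x = y) /\
    (forall (f f' : hom a a') (x x' : cell f f'), F2 P x = F2 P x' -> x = x').

Ltac push := repeat push_act2_goal; cbn [act actr ev]; vnorm.

Ltac cancel H :=
  lazymatch type of H with
  | vcomp ?x ?y = _ =>
    match goal with |- context [act2 ?s ?t _ x] => vrw (@act2_inverse _ _ _ s t x y H) end
  end.
Ltac wcancel H :=
  lazymatch type of H with
  | vcomp ?x ?y = _ =>
    match goal with |- context [act2 ?s ?t _ x] => wrw (@act2_inverse _ _ _ s t x y H) end
  end.

Section LocalInverse.
Context {C A : Bicat} {P : psfunctor_data C A} (HP : is_psfunctor P)
  {L1 : forall [a a' : C], hom (P a) (P a') -> hom a a'}
  {sg : forall [a a' : C] (g : hom (P a) (P a')), cell (F1 P (L1 g)) g}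
  {sgI : forall [a a' : C] (g : hom (P a) (P a')), cell g (F1 P (L1 g))}
  {lift : forall [a a' : C] [f f' : hom a a'], cell (F1 P f) (F1 P f') -> cell f f'}
  (sg_sgI : forall (a a' : C) (g : hom (P a) (P a')), vcomp (sg g) (sgI g) = id2 _)
  (sgI_sg : forall (a a' : C) (g : hom (P a) (P a')), vcomp (sgI g) (sg g) = id2 _)
  (F2_lift : forall (a a' : C) (f f' : hom a a') (y : cell (F1 P f) (F1 P f')),
     F2 P (lift y) = y)
  (F2_inj : forall (a a' : C) (f f' : hom a a') (x x' : cell f f'), F2 P x = F2 P x' -> x = x').

Lemma invertible_lift a a' (f f' : hom a a') (y : cell (F1 P f) (F1 P f')) :
  is_invertible y -> is_invertible (lift y).
Proof.
  intros [z [H1 H2]]. exists (lift z).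
  split; apply F2_inj; now rewrite (F2_vcomp HP), !F2_lift, (F2_id2 HP).
Qed.

Lemma invertible_sg a a' (g : hom (P a) (P a')) : is_invertible (sg g).
Proof. exists (sgI g). split; [apply sg_sgI | apply sgI_sg]. Qed.

Lemma invertible_sgI a a' (g : hom (P a) (P a')) : is_invertible (sgI g).
Proof. exists (sg g). split; [apply sgI_sg | apply sg_sgI]. Qed.

(** Each 2-cell is the lift of the 2-cell of [A] that its image under [P] must be, namely the
    evident one conjugated by the isomorphisms [sg]. *)
Definition local_inverse : psfunctor_data (pull (F0 P)) C :=
  @Build_psfunctor_data (pull (F0 P)) C (fun c => c) (fun a b f => L1 f)
    (fun a b f g x => lift (vcomp (sg f) (vcomp x (sgI g))))
    (fun c => lift (vcomp (Fid_inv HP c) (sgI (id1 (P c)))))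
    (fun a b c f g => lift (vcomp (Fcomp_inv HP (L1 f) (L1 g))
       (vcomp (rwhisker (F1 P (L1 g)) (sg f))
         (vcomp (@lwhisker A (P a) (P b) (P c) f _ _ (sg g))
           (sgI (@comp1 A (P a) (P b) (P c) f g)))))).

Definition pull_psfunctor : psfunctor_data C (pull (F0 P)) :=
  @Build_psfunctor_data C (pull (F0 P)) (fun c => c) (@F1 _ _ P) (@F2 _ _ P) (Fid P)
    (@Fcomp _ _ P).

Ltac unfold_pull :=
  repeat match goal with
  | x : ob (bicat_data_of (pull _)) |- _ => change (ob C) in x
  | x : @hom (bicat_data_of (pull _)) ?a ?b |- _ => change (@hom A (P a) (P b)) in x
  | x : @cell (bicat_data_of (pull _)) ?a ?b ?f ?g |- _ =>
      change (@cell A (P a) (P b) f g) in x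
  end;
  cbn [local_inverse pull_psfunctor comp_psfunctor id_psfunctor F0 F1 F2 Fid Fcomp
    pull pull_data bicat_data_of ob hom cell id1 comp1 id2 vcomp lwhisker rwhisker lunitor
    runitor lassociator].

Lemma is_psfunctor_local_inverse : is_psfunctor local_inverse.
Proof.
  (* Equations of 2-cells in [C] are tested after [P], where [F2_lift] evaluates the lifts. *)
  repeat split; intros; unfold_pull; try apply F2_inj.
  - rewrite F2_lift, (F2_id2 HP), id2_left. apply sg_sgI.
  - rewrite (F2_vcomp HP), !F2_lift, !vassoc. do 2 f_equal.
    now rewrite <- (vassoc (sgI g)), sgI_sg, id2_left.
  - rewrite !(F2_vcomp HP), !F2_lift. strictify.
    apply (inv_cancel_left (invertible_C HP (@id1 C a) (L1 f) u)).
    vrw <- (Fcomp_rwhisker HP). rewrite F2_lift. push. vrw (Fcomp_vcomp_inv HP).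
    wcancel (sgI_sg (id1 (P a))). cancel (sgI_sg (comp1 (id1 (P a)) f)). cancel (sg_sgI f).
    apply (inv_cancel_left (invertible_rwhisker (F1 P (L1 f))
      (invertible_act2 (s := Pid _) (t := Pv _) u (invertible_Fid HP a)))).
    vrw (Fid_lunitor HP). wrw (Fid_vcomp_inv HP). reflexivity.
  - rewrite !(F2_vcomp HP), !F2_lift. strictify.
    apply (inv_cancel_left (invertible_C HP (L1 f) (id1 b) u)).
    vrw <- (Fcomp_lwhisker HP). rewrite F2_lift. push. vrw (Fcomp_vcomp_inv HP).
    exchange_back (sgI (id1 (P b))).
    cancel (sgI_sg (id1 (P b))). cancel (sgI_sg (comp1 f (id1 (P b)))).
    apply (inv_cancel_left (invertible_act2 (s := Pid _) (t := Pv _)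
      (comp1 u (F1 P (L1 f))) (invertible_Fid HP b))).
    vrw (Fid_runitor HP). vrw (Fid_vcomp_inv HP).  cancel (sg_sgI f). reflexivity.
  - rewrite !(F2_vcomp HP), !F2_lift. strictify.
    apply (inv_cancel_left (invertible_C HP (L1 f) (comp1 (L1 g) (L1 h)) u)).
    apply (inv_cancel_left (invertible_C HP (L1 g) (L1 h) (comp1 u (F1 P (L1 f))))).
    vrw <- (Fcomp_lwhisker HP). vrw (Fcomp_lassociator HP). vrw <- (Fcomp_rwhisker HP).
    rewrite !F2_lift. push.
    do 3 vrw (Fcomp_vcomp_inv HP). wrw (Fcomp_vcomp_inv HP). wcancel (sgI_sg (comp1 f g)).
    exchange_back (sgI (comp1 g h)). cancel (sgI_sg (comp1 g h)).
    exchange_back (sg h). wexchange_back (sg g). cancel (sgI_sg (comp1 f (comp1 g h))).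
    reflexivity.
  - rewrite !(F2_vcomp HP), !F2_lift. strictify.
    apply (inv_cancel_left (invertible_C HP (L1 f) (L1 g1) u)).
    vrw <- (Fcomp_lwhisker HP). rewrite !F2_lift. push. do 2 vrw (Fcomp_vcomp_inv HP).
    exchange_back (sgI g2). cancel (sgI_sg g2). exchange_back x. exchange_back (sg g1).
    cancel (sgI_sg (comp1 f g1)). reflexivity.
  - rewrite !(F2_vcomp HP), !F2_lift. strictify.
    apply (inv_cancel_left (invertible_C HP (L1 f1) (L1 g) u)).
    vrw <- (Fcomp_rwhisker HP). rewrite !F2_lift. push. do 2 vrw (Fcomp_vcomp_inv HP).
    wcancel (sgI_sg f2). cancel (sgI_sg (comp1 f1 g)). exchange (sg g). reflexivity.
  - apply invertible_lift, invertible_vcomp; [apply invertible_inv | apply invertible_sgI].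
  - apply invertible_lift. repeat apply invertible_vcomp;
    auto using invertible_sg, invertible_sgI, invertible_rwhisker, invertible_lwhisker.
    apply invertible_inv.
Qed.

(** The composite fixes objects, so an icon suffices: its component at [f] lifts the chosen
    isomorphism from [F1 P f] to the image of [L1 (F1 P f)]. *)
Lemma pull_psfunctor_local_inverse :
  equivalence_transformation (comp_psfunctor pull_psfunctor local_inverse) (id_psfunctor C).
Proof.
  apply (icon_transformation (F := comp_psfunctor pull_psfunctor local_inverse)
    (G1 := fun a b f => f) (G2 := fun a b f g x => x) (Gid := fun a => id2 (id1 a))
    (Gcomp := fun a b c f g => id2 (comp1 f g))
    (tau := fun a b f => lift (sgI (F1 P f)))); intros; unfold_pull.
  - apply invertible_lift, invertible_sgI.
  - apply F2_inj. rewrite !(F2_vcomp HP), !F2_lift, <- (vassoc (sgI _)), sgI_sg, id2_left.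
    reflexivity.
  - rewrite id2_left. apply F2_inj. rewrite !(F2_vcomp HP), !F2_lift, !vassoc.
    rewrite <- (vassoc (sgI _)), sgI_sg, id2_left, <- vassoc. unfold Fid_inv.
    rewrite inv_vcomp, id2_left. reflexivity.
  - rewrite id2_left. apply F2_inj. rewrite !(F2_vcomp HP), !F2_lift. strictify.
    apply (inv_cancel_left (invertible_C HP f g u)).
    vrw <- (Fcomp_rwhisker HP). vrw <- (Fcomp_lwhisker HP). rewrite !F2_lift. push.
    vrw (Fcomp_vcomp_inv HP). exchange (sgI (F1 P g)).
    cancel (sgI_sg (comp1 (F1 P f) (F1 P g))). wcancel (sgI_sg (F1 P f)).
    cancel (sgI_sg (F1 P g)). reflexivity.
Qed.

Lemma local_inverse_pull_psfunctor :
  equivalence_transformation (comp_psfunctor local_inverse pull_psfunctor)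
    (id_psfunctor (pull (F0 P))).
Proof.
  apply (icon_transformation (F := comp_psfunctor local_inverse pull_psfunctor)
    (G1 := fun a b f => f) (G2 := fun a b f g x => x)
    (Gid := fun a => @id2 (pull (F0 P)) _ _ (id1 a))
    (Gcomp := fun a b c f g => @id2 (pull (F0 P)) _ _ (comp1 f g))
    (tau := fun a b f => sgI f)); intros; unfold_pull.
  - apply invertible_sgI.
  - now rewrite F2_lift, <- vassoc, sgI_sg, id2_left.
  - rewrite id2_left, F2_lift, <- vassoc. unfold Fid_inv. now rewrite vcomp_inv, id2_left.
  - rewrite id2_left, F2_lift. strictify. vrw (Fcomp_vcomp_inv HP).
    exchange_back (sgI g). wcancel (sgI_sg f). cancel (sgI_sg g). reflexivity.
Qed.
End LocalInverse.

Lemma biequivalent_pull_local {C A : Bicat} (P : psfunctor_data C A) :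
  is_psfunctor P -> local_equivalence P -> biequivalent C (pull (F0 P)).
Proof.
  intros HP HL.
  assert (Hs : forall q : {a & {a' & hom (P a) (P a')}},
    exists r : {f : hom (projT1 q) (projT1 (projT2 q)) &
      (cell (F1 P f) (projT2 (projT2 q)) * cell (projT2 (projT2 q)) (F1 P f))%type},
      inverse_pair (fst (projT2 r)) (snd (projT2 r))).
  { intros (a & a' & g). destruct (HL a a') as [H _]. destruct (H g) as (f & x & y & Hxy).
    exists (existT _ f (x, y)). exact Hxy. }
  assert (Hl : forall q : {a & {a' & {f : hom a a' & {f' : hom a a' & cell (F1 P f) (F1 P f')}}}},
    exists x : cell (projT1 (projT2 (projT2 q))) (projT1 (projT2 (projT2 (projT2 q)))),
      F2 P x = projT2 (projT2 (projT2 (projT2 q)))).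
  { intros (a & a' & f & f' & y). apply (HL a a'). }
  pose (r := fun a a' g => constructive_indefinite_description _ (Hs (existT _ a (existT _ a' g)))).
  pose (l := fun a a' f f' y => constructive_indefinite_description _
    (Hl (existT _ a (existT _ a' (existT _ f (existT _ f' y)))))).
  pose proof (fun a a' => proj2 (proj2 (HL a a'))) as Hinj.
  rewrite biequivalentE.
  pose (sg_sgI := fun a a' g => proj1 (proj2_sig (r a a' g))).
  pose (sgI_sg := fun a a' g => proj2 (proj2_sig (r a a' g))).
  pose (F2_lift := fun a a' f f' y => proj2_sig (l a a' f f' y)).
  exists (pull_psfunctor (P := P)).
  exists (@local_inverse C A P HP (fun a a' g => projT1 (proj1_sig (r a a' g)))
    (fun a a' g => fst (projT2 (proj1_sig (r a a' g))))
    (fun a a' g => snd (projT2 (proj1_sig (r a a' g))))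
    (fun a a' f f' y => proj1_sig (l a a' f f' y))).
  split; [exact HP |]. split; [| split].
  - now apply is_psfunctor_local_inverse.
  - now apply pull_psfunctor_local_inverse.
  - now apply local_inverse_pull_psfunctor.
Qed.

Lemma biequivalent_of_surjective_equivalence {C A : Bicat} (P : psfunctor C A) :
  is_surjective_equivalence P -> biequivalent C A.
Proof.
  intros [H0 H1]. apply biequivalent_trans with (pull (F0 P)); [| now apply biequivalent_pull].
  apply biequivalent_pull_local; [apply P |]. intros a a'.
  destruct (H1 a a') as (Hs & Hf & Hi). split; [| now split].
  intros g. destruct (Hs g) as [f <-]. exists f, (id2 _). apply invertible_id2.
Qed.

(** ** Biequivalences are local equivalences *)

Section WhiskerEquivalence.
Context {B : Bicat}.

(** Whiskering further by an inverse [v] of [w] gives a 2-cell that the counit conjugates back to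
    the original one. *)
Lemma lwhisker_equivalence_inj (a b c : B) (w : hom a b) (f g : hom b c) (x x' : cell f g) :
  equivalence w -> lwhisker w x = lwhisker w x' -> x = x'.
Proof.
  intros (v & eta & eps & _ & Heps) H. strictify.
  strictify_in H (comp1 u v).
  apply (inv_cancel_left (invertible_rwhisker f
    (invertible_act2 (s := Pc (Pv v) (Pv w)) (t := Pid _) u Heps))).
  exchange x. exchange x'. now rewrite H.
Qed.

Lemma rwhisker_equivalence_inj (a b c : B) (w : hom b c) (f g : hom a b) (x x' : cell f g) :
  equivalence w -> rwhisker w x = rwhisker w x' -> x = x'.
Proof.
  intros (v & eta & eps & Heta & _) H. strictify. strictify_in H u.
  apply (inv_cancel_right
    (invertible_act2 (s := Pid _) (t := Pc (Pv w) (Pv v)) (comp1 u g) Heta)).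
  exchange eta. exchange eta. now rewrite H.
Qed.

Lemma equivalence_inverse (a b : B) (w : hom a b) : equivalence w ->
  exists (v : hom b a) (eta : cell (id1 a) (comp1 w v)) (eps : cell (comp1 v w) (id1 b)),
    is_invertible eta /\ is_invertible eps /\ equivalence v.
Proof.
  intros (v & eta & eps & Heta & Heps). exists v, eta, eps.
  split; [exact Heta | split; [exact Heps |]].
  exists w, (inv Heps), (inv Heta). split; apply invertible_inv.
Qed.

(** The preimage is [y] whiskered by the inverse [v] and conjugated by the counit. It is checked
    after whiskering by [v], which is faithful because [v] is an equivalence too; this replaces an
    appeal to the triangle identities. *)
Lemma lwhisker_equivalence_full (a b c : B) (w : hom a b) (f g : hom b c)
  (y : cell (comp1 w f) (comp1 w g)) :
  equivalence w -> exists x : cell f g, lwhisker w x = y.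
Proof.
  intros Hw. destruct (equivalence_inverse Hw) as (v & eta & eps & _ & Heps & Hv).
  pose proof Heps as (epsI & E1 & E2).
  set (x := vcomp (linvunitor f) (vcomp (rwhisker f epsI) (vcomp (rassociator v w f)
    (vcomp (lwhisker v y) (vcomp (lassociator v w g) (vcomp (rwhisker g eps) (lunitor g))))))).
  assert (X : x = vcomp (linvunitor f) (vcomp (rwhisker f epsI) (vcomp (rassociator v w f)
    (vcomp (lwhisker v y) (vcomp (lassociator v w g) (vcomp (rwhisker g eps) (lunitor g)))))))
    by reflexivity.
  (* With its body hidden, [x] is one generator for the translation and can be moved by interchange;
     [X] reinstates the definition afterwards. *)
  clearbody x. exists x. apply (lwhisker_equivalence_inj Hv). strictify.
  apply (inv_cancel_right (invertible_rwhisker g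
    (invertible_act2 (s := Pc (Pv v) (Pv w)) (t := Pid _) u Heps))).
  exchange_back x. strictify_in X u. rewrite X. wcancel E1. reflexivity.
Qed.

Lemma rwhisker_equivalence_full (a b c : B) (w : hom b c) (f g : hom a b)
  (y : cell (comp1 f w) (comp1 g w)) :
  equivalence w -> exists x : cell f g, rwhisker w x = y.
Proof.
  intros Hw. destruct (equivalence_inverse Hw) as (v & eta & eps & Heta & _ & Hv).
  pose proof Heta as (etaI & E1 & E2).
  set (x := vcomp (rinvunitor f) (vcomp (lwhisker f eta) (vcomp (lassociator f w v)
    (vcomp (rwhisker v y) (vcomp (rassociator g w v) (vcomp (lwhisker g etaI) (runitor g))))))).
  assert (X : x = vcomp (rinvunitor f) (vcomp (lwhisker f eta) (vcomp (lassociator f w v)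
    (vcomp (rwhisker v y) (vcomp (rassociator g w v) (vcomp (lwhisker g etaI) (runitor g)))))))
    by reflexivity.
  clearbody x. exists x. apply (rwhisker_equivalence_inj Hv). strictify.
  apply (inv_cancel_left
    (invertible_act2 (s := Pid _) (t := Pc (Pv w) (Pv v)) (comp1 u f) Heta)).
  pose proof (act2_exchange (Pid _) (Pc (Pv w) (Pv v)) (act2 (Pv f) (Pv g) u x) eta) as N.
  cbn [act actr ev] in N |- *. rewrite <- N.
  strictify_in X u. rewrite X. vnorm. cancel E2. reflexivity.
Qed.

Lemma lwhisker_equivalence_lift (a b c : B) (w : hom a b) (k : hom a c) :
  equivalence w -> exists (g : hom b c) (x : cell k (comp1 w g)), is_invertible x.
Proof.
  intros (v & eta & eps & Heta & _).
  exists (comp1 v k), (vcomp (linvunitor k) (vcomp (rwhisker k eta) (rassociator w v k))).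
  auto using invertible_vcomp, invertible_linvunitor, invertible_rwhisker,
    invertible_rassociator.
Qed.

Lemma rwhisker_equivalence_lift (a b c : B) (w : hom b c) (k : hom a c) :
  equivalence w -> exists (g : hom a b) (x : cell (comp1 g w) k), is_invertible x.
Proof.
  intros (v & eta & eps & _ & Heps).
  exists (comp1 k v), (vcomp (rassociator k v w) (vcomp (lwhisker k eps) (runitor k))).
  auto using invertible_vcomp, invertible_runitor, invertible_lwhisker,
    invertible_rassociator.
Qed.

Lemma rwhisker_equivalence_reflect (a b c : B) (w : hom b c) (f g : hom a b) (x : cell f g) :
  equivalence w -> is_invertible (rwhisker w x) -> is_invertible x.
Proof.
  intros Hw [y [H1 H2]]. destruct (rwhisker_equivalence_full y Hw) as [x' <-].
  exists x'. split; apply (rwhisker_equivalence_inj Hw);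
  now rewrite rwhisker_vcomp, id2_rwhisker.
Qed.

End WhiskerEquivalence.

(** Naturality of [s] expresses [x] whiskered by the equivalence [s a] through its image under [F]
    followed by [G]. *)
Lemma retraction_faithful {A B : Bicat} (F : psfunctor_data A B) (G : psfunctor_data B A)
  (s : pstrans_data (comp_psfunctor F G) (id_psfunctor A)) :
  is_pstrans s -> (forall a, equivalence (s a)) ->
  forall (a b : A) (f g : hom a b) (x x' : cell f g), F2 F x = F2 F x' -> x = x'.
Proof.
  intros Hs Es a b f g x x' H. apply (lwhisker_equivalence_inj (Es a)).
  apply (inv_cancel_right (invertible_psnat Hs g)).
  pose proof (psnat_nat_law Hs x) as E. pose proof (psnat_nat_law Hs x') as E'.
  cbn [F2 id_psfunctor comp_psfunctor] in E, E'. rewrite H in E.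
  etransitivity; [exact E | symmetry; exact E'].
Qed.

(** Naturality of [s] is solved for [x] with [F2 G y] in place of the double image of [x]. The
    solution has the same image as [y] under [G], and [G] is faithful. *)
Lemma retraction_full {A B : Bicat} (F : psfunctor_data A B) (G : psfunctor_data B A)
  (s : pstrans_data (comp_psfunctor F G) (id_psfunctor A)) :
  is_pstrans s -> (forall a, equivalence (s a)) ->
  (forall (a b : B) (f g : hom a b) (x x' : cell f g), F2 G x = F2 G x' -> x = x') ->
  forall (a b : A) (f g : hom a b) (y : cell (F1 F f) (F1 F g)), exists x, F2 F x = y.
Proof.
  intros Hs Es HG a b f g y.
  destruct (lwhisker_equivalence_full (w := s a) (vcomp (psnat s f)
    (vcomp (rwhisker (s b) (F2 G y)) (psnat_inv Hs g))) (Es a)) as [x Hx].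
  exists x. apply HG, (rwhisker_equivalence_inj (Es b)).
  apply (inv_cancel_left (invertible_psnat Hs f)).
  etransitivity; [symmetry; apply (psnat_nat_law Hs x) |].
  etransitivity; [exact (f_equal (fun q => vcomp q (psnat s g)) Hx) |].
  cbv beta. rewrite !vassoc. unfold psnat_inv.
  rewrite inv_vcomp, id2_right. reflexivity.
Qed.

(** Factoring [G g] followed by [s b] through the equivalence [s a] produces [f]. Naturality of [s]
    then gives an isomorphism between the [G]-images of [F1 F f] and [g], after [s b] is cancelled;
    it is reflected along the locally fully faithful [G]. *)
Lemma retraction_essentially_surjective {A B : Bicat} (F : psfunctor_data A B)
  (G : psfunctor_data B A) (s : pstrans_data (comp_psfunctor F G) (id_psfunctor A)) :
  is_psfunctor G -> is_pstrans s -> (forall a, equivalence (s a)) ->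
  (forall (a b : B) (f g : hom a b) (x x' : cell f g), F2 G x = F2 G x' -> x = x') ->
  (forall (a b : B) (f g : hom a b) (y : cell (F1 G f) (F1 G g)), exists x, F2 G x = y) ->
  forall (a b : A) (g : hom (F a) (F b)),
    exists (f : hom a b) (x : cell (F1 F f) g), is_invertible x.
Proof.
  intros HG Hs Es Ginj Gfull a b g.
  destruct (lwhisker_equivalence_lift (w := s a) (comp1 (F1 G g) (s b)) (Es a))
    as (f & x & Hx).
  destruct (rwhisker_equivalence_full (w := s b) (f := F1 G (F1 F f)) (g := F1 G g)
    (vcomp (psnat_inv Hs f) (inv Hx)) (Es b)) as (y & Hy).
  assert (Iy : is_invertible y).
  { apply (rwhisker_equivalence_reflect (Es b)). rewrite Hy.
    apply invertible_vcomp; apply invertible_inv. }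
  destruct Iy as (y' & E1 & E2).
  destruct (Gfull _ _ _ _ y) as (z & Hz). destruct (Gfull _ _ _ _ y') as (z' & Hz').
  exists f, z, z'. split; apply Ginj; rewrite (F2_vcomp HG), (F2_id2 HG).
  - exact (eq_trans (f_equal2 vcomp Hz Hz') E1).
  - exact (eq_trans (f_equal2 vcomp Hz' Hz) E2).
Qed.

(** The two transformations are used alternately: each gives faithfulness of one pseudofunctor,
    which gives fullness of the other; full faithfulness of [G] then yields essential surjectivity
    of [F]. *)
Lemma local_equivalence_of_inverse {A B : Bicat} (F : psfunctor_data A B)
  (G : psfunctor_data B A) : is_psfunctor G ->
  equivalence_transformation (comp_psfunctor F G) (id_psfunctor A) ->
  equivalence_transformation (comp_psfunctor G F) (id_psfunctor B) ->
  local_equivalence F.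
Proof.
  intros HG (s & Hs & Es) (t & Ht & Et) a a'.
  pose proof (retraction_faithful Hs Es) as Finj.
  pose proof (retraction_faithful Ht Et) as Ginj.
  pose proof (retraction_full Hs Es Ginj) as Ffull.
  pose proof (retraction_full Ht Et Finj) as Gfull.
  split; [| split]; auto.
  now apply (retraction_essentially_surjective HG Hs Es).
Qed.

(** ** The bicategory of equivalences [F a -> b] *)

Section Comma.
Context {A B : Bicat} {F : psfunctor_data A B} (HF : is_psfunctor F).

Notation C f g := (act2 (Pc (Pv (F1 F f)) (Pv (F1 F g))) (Pv (F1 F (comp1 f g)))).
Notation C' f g := (act2 (Pv (F1 F (comp1 f g))) (Pc (Pv (F1 F f)) (Pv (F1 F g)))).
Notation V f g := (act2 (Pv (F1 F f)) (Pv (F1 F g))).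

(** Solved for the image of the unitor, because the square of a composite 1-cell of [comma] begins
    with the inverse compositor. *)
Lemma F2_lunitor_strict a b (f : hom a b) y (u : hom y (F a)) :
  V (comp1 (id1 a) f) f u (F2 F (lunitor f))
  = vcomp (C' (id1 a) f u (Fcomp_inv HF (id1 a) f))
      (rwhisker (F1 F f) (act2 (Pv _) (Pid _) u (Fid_inv HF a))).
Proof.
  apply (inv_cancel_left (invertible_C HF (id1 a) f u)).
  apply (inv_cancel_left (invertible_rwhisker (F1 F f)
    (invertible_act2 (s := Pid _) (t := Pv _) u (invertible_Fid HF a)))).
  vrw (Fid_lunitor HF). vrw (Fcomp_vcomp_inv HF). wrw (Fid_vcomp_inv HF). reflexivity.
Qed.

Lemma F2_runitor_strict a b (f : hom a b) y (u : hom y (F a)) :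
  V (comp1 f (id1 b)) f u (F2 F (runitor f))
  = vcomp (C' f (id1 b) u (Fcomp_inv HF f (id1 b)))
      (act2 (Pv _) (Pid _) (comp1 u (F1 F f)) (Fid_inv HF b)).
Proof.
  apply (inv_cancel_left (invertible_C HF f (id1 b) u)).
  apply (inv_cancel_left
    (invertible_act2 (s := Pid _) (t := Pv _) (comp1 u (F1 F f)) (invertible_Fid HF b))).
  vrw (Fid_runitor HF). vrw (Fcomp_vcomp_inv HF). vrw (Fid_vcomp_inv HF). reflexivity.
Qed.

Lemma F2_lassociator_strict a b c d (f : hom a b) (g : hom b c) (h : hom c d) y
  (u : hom y (F a)) :
  vcomp (V (comp1 f (comp1 g h)) (comp1 (comp1 f g) h) u (F2 F (lassociator f g h)))
   (vcomp (C' (comp1 f g) h u (Fcomp_inv HF (comp1 f g) h))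
          (rwhisker (F1 F h) (C' f g u (Fcomp_inv HF f g))))
  = vcomp (C' f (comp1 g h) u (Fcomp_inv HF f (comp1 g h)))
          (C' g h (comp1 u (F1 F f)) (Fcomp_inv HF g h)).
Proof.
  apply (inv_cancel_left (invertible_C HF f (comp1 g h) u)).
  vrw (Fcomp_inv_lassociator HF). do 2 vrw (Fcomp_vcomp_inv HF).
  wrw (Fcomp_vcomp_inv HF). reflexivity.
Qed.

Lemma Fcomp_inv_lwhisker a b c (f : hom a b) (g1 g2 : hom b c) (x : cell g1 g2) y
  (u : hom y (F a)) :
  vcomp (V (comp1 f g1) (comp1 f g2) u (F2 F (lwhisker f x))) (C' f g2 u (Fcomp_inv HF f g2))
  = vcomp (C' f g1 u (Fcomp_inv HF f g1)) (V g1 g2 (comp1 u (F1 F f)) (F2 F x)).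
Proof.
  apply (inv_cancel_left (invertible_C HF f g1 u)).
  vrw <- (Fcomp_lwhisker HF). do 2 vrw (Fcomp_vcomp_inv HF). reflexivity.
Qed.

(** The pseudo-comma construction of [F] over the identity of [B], restricted to objects whose arrow
    is an equivalence. *)
Record comma_ob : Type := {
  src : A; tgt : B; arr : hom (F src) tgt; arr_equivalence : equivalence arr }.

Record comma_hom (x y : comma_ob) : Type := {
  hsrc : hom (src x) (src y);
  htgt : hom (tgt x) (tgt y);
  sq : cell (comp1 (F1 F hsrc) (arr y)) (comp1 (arr x) htgt);
  sq_invertible : is_invertible sq }.

Definition compatible {x y} (p q : comma_hom x y) (al : cell (hsrc p) (hsrc q))
  (be : cell (htgt p) (htgt q)) : Prop :=
  vcomp (rwhisker (arr y) (F2 F al)) (sq q) = vcomp (sq p) (lwhisker (arr x) be).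

Definition comma_cell {x y} (p q : comma_hom x y) : Type :=
  { c : cell (hsrc p) (hsrc q) * cell (htgt p) (htgt q) | compatible (fst c) (snd c) }.

Definition csrc {x y} {p q : comma_hom x y} (c : comma_cell p q) := fst (proj1_sig c).
Definition ctgt {x y} {p q : comma_hom x y} (c : comma_cell p q) := snd (proj1_sig c).

Definition mk_cell {x y} {p q : comma_hom x y} al be (H : compatible (p := p) (q := q) al be) :
  comma_cell p q := exist _ (al, be) H.

(** Reduces every equation of 2-cells to one in [A] and one in [B]. *)
Lemma comma_cell_eq x y (p q : comma_hom x y) (c d : comma_cell p q) :
  csrc c = csrc d -> ctgt c = ctgt d -> c = d.
Proof.
  destruct c as [[al be] H], d as [[al' be'] H']. unfold csrc, ctgt; simpl.
  intros -> ->. f_equal. apply proof_irrelevance.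
Qed.

Definition comma_id x : comma_hom x x :=
  {| hsrc := id1 (src x); htgt := id1 (tgt x);
     sq := vcomp (rwhisker (arr x) (Fid_inv HF (src x)))
             (vcomp (lunitor (arr x)) (rinvunitor (arr x)));
     sq_invertible := invertible_vcomp
       (invertible_rwhisker (arr x) (invertible_inv (invertible_Fid HF (src x))))
       (invertible_vcomp (invertible_lunitor (arr x)) (invertible_rinvunitor (arr x))) |}.

(** The two squares pasted side by side. The compositor of [F] is absorbed into the square, which
    leaves both components of a composite equal to [comp1] and makes the projections strict. *)
Definition comp_sq {x y z} (p : comma_hom x y) (q : comma_hom y z) :
  cell (comp1 (F1 F (comp1 (hsrc p) (hsrc q))) (arr z))
    (comp1 (arr x) (comp1 (htgt p) (htgt q))) :=
  vcomp (rwhisker (arr z) (Fcomp_inv HF (hsrc p) (hsrc q)))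
 (vcomp (rassociator (F1 F (hsrc p)) (F1 F (hsrc q)) (arr z))
 (vcomp (lwhisker (F1 F (hsrc p)) (sq q))
 (vcomp (lassociator (F1 F (hsrc p)) (arr y) (htgt q))
 (vcomp (rwhisker (htgt q) (sq p)) (rassociator (arr x) (htgt p) (htgt q)))))).

Lemma invertible_comp_sq x y z (p : comma_hom x y) (q : comma_hom y z) :
  is_invertible (comp_sq p q).
Proof.
  pose proof (@sq_invertible). unfold comp_sq, Fcomp_inv. repeat apply invertible_vcomp;
  auto using invertible_rwhisker, invertible_lwhisker, invertible_rassociator,
    invertible_lassociator, invertible_inv.
Qed.

Definition comma_comp x y z (p : comma_hom x y) (q : comma_hom y z) : comma_hom x z :=
  {| hsrc := comp1 (hsrc p) (hsrc q); htgt := comp1 (htgt p) (htgt q);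
     sq := comp_sq p q; sq_invertible := invertible_comp_sq p q |}.

Ltac unfold_comma :=
  unfold compatible; repeat (cbn [hsrc htgt sq comma_id comma_comp]; unfold comp_sq at 1);
  cbn [hsrc htgt sq comma_id comma_comp].

Lemma compatible_id x y (p : comma_hom x y) : compatible (id2 (hsrc p)) (id2 (htgt p)).
Proof.
  unfold compatible. now rewrite (F2_id2 HF), id2_rwhisker, lwhisker_id2, id2_left, id2_right.
Qed.

Lemma compatible_vcomp x y (p q r : comma_hom x y) (c : comma_cell p q) (d : comma_cell q r) :
  compatible (vcomp (csrc c) (csrc d)) (vcomp (ctgt c) (ctgt d)).
Proof.
  destruct c as [[al be] H], d as [[al' be'] H']. unfold compatible, csrc, ctgt in *; simpl in *.
  rewrite (F2_vcomp HF), rwhisker_vcomp, vassoc, H', <- vassoc, H, vassoc, lwhisker_vcomp.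
  reflexivity.
Qed.

Lemma compatible_strict x y (p q : comma_hom x y) (c : comma_cell p q) z
  (u : hom z (F (src x))) :
  vcomp (rwhisker (arr y) (V (hsrc p) (hsrc q) u (F2 F (csrc c))))
    (act2 (Pc (Pv (F1 F (hsrc q))) (Pv (arr y))) (Pc (Pv (arr x)) (Pv (htgt q))) u (sq q))
  = vcomp
    (act2 (Pc (Pv (F1 F (hsrc p))) (Pv (arr y))) (Pc (Pv (arr x)) (Pv (htgt p))) u (sq p))
    (act2 (Pv (htgt p)) (Pv (htgt q)) (comp1 u (arr x)) (ctgt c)).
Proof.
  pose proof (proj2_sig c) as H. unfold compatible in H. strictify_in H u. exact H.
Qed.

Lemma compatible_lwhisker x y z (p : comma_hom x y) (q r : comma_hom y z) (c : comma_cell q r) :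
  compatible (p := comma_comp p q) (q := comma_comp p r)
    (lwhisker (hsrc p) (csrc c)) (lwhisker (htgt p) (ctgt c)).
Proof.
  unfold_comma. strictify. wrw Fcomp_inv_lwhisker. vrw (compatible_strict c).
  exchange_back (ctgt c). reflexivity.
Qed.

Lemma compatible_rwhisker x y z (p q : comma_hom x y) (r : comma_hom y z) (c : comma_cell p q) :
  compatible (p := comma_comp p r) (q := comma_comp q r)
    (rwhisker (hsrc r) (csrc c)) (rwhisker (htgt r) (ctgt c)).
Proof.
  unfold_comma. strictify. wrw (Fcomp_inv_rwhisker HF). exchange (sq r).
  wrw (compatible_strict c). reflexivity.
Qed.

Lemma compatible_lunitor x y (p : comma_hom x y) :
  compatible (p := comma_comp (comma_id x) p) (q := p) (lunitor (hsrc p)) (lunitor (htgt p)).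
Proof.
  unfold_comma. strictify. rewrite F2_lunitor_strict. vnorm.
  exchange (sq p). reflexivity.
Qed.

Lemma compatible_runitor x y (p : comma_hom x y) :
  compatible (p := comma_comp p (comma_id y)) (q := p) (runitor (hsrc p)) (runitor (htgt p)).
Proof.
  unfold_comma. strictify. rewrite F2_runitor_strict. vnorm. reflexivity.
Qed.


Lemma compatible_lassociator x y z w (p : comma_hom x y) (q : comma_hom y z) (r : comma_hom z w) :
  compatible (p := comma_comp p (comma_comp q r)) (q := comma_comp (comma_comp p q) r)
    (lassociator (hsrc p) (hsrc q) (hsrc r)) (lassociator (htgt p) (htgt q) (htgt r)).
Proof.
  unfold_comma. strictify. exchange_back (sq r). wrw F2_lassociator_strict. reflexivity.
Qed.

(** Spares separate pasting computations for the inverse unitors and the inverse associator. *)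
Lemma compatible_inverse x y (p q : comma_hom x y) al be al' be' :
  vcomp al al' = id2 _ -> vcomp al' al = id2 _ -> vcomp be be' = id2 _ ->
  compatible (p := p) (q := q) al be -> compatible (p := q) (q := p) al' be'.
Proof.
  intros H1 H2 H3 H. unfold compatible in *.
  assert (I : is_invertible (rwhisker (arr y) (F2 F al))).
  { apply invertible_rwhisker, (invertible_F2 HF). now exists al'. }
  apply (inv_cancel_left I).
  rewrite <- vassoc, <- rwhisker_vcomp, <- (F2_vcomp HF), H1, (F2_id2 HF), id2_rwhisker, id2_left.
  rewrite <- vassoc, H, vassoc, <- lwhisker_vcomp, H3, lwhisker_id2, id2_right. reflexivity.
Qed.

Definition comma_data : bicat_data :=
  {| ob := comma_ob;
     hom := comma_hom;
     cell := fun x y p q => comma_cell p q;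
     id1 := comma_id;
     comp1 := fun x y z p q => comma_comp p q;
     id2 := fun x y p => mk_cell (compatible_id p);
     vcomp := fun x y p q r c d => mk_cell (compatible_vcomp c d);
     lwhisker := fun x y z p q r c => mk_cell (compatible_lwhisker p c);
     rwhisker := fun x y z p q r c => mk_cell (compatible_rwhisker r c);
     lunitor := fun x y p => mk_cell (compatible_lunitor p);
     linvunitor := fun x y p => mk_cell (compatible_inverse
       (p := comma_comp (comma_id x) p) (q := p) (lunitor_linvunitor (hsrc p))
       (linvunitor_lunitor (hsrc p)) (lunitor_linvunitor (htgt p)) (compatible_lunitor p));
     runitor := fun x y p => mk_cell (compatible_runitor p);
     rinvunitor := fun x y p => mk_cell (compatible_inverse
       (p := comma_comp p (comma_id y)) (q := p) (runitor_rinvunitor (hsrc p))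
       (rinvunitor_runitor (hsrc p)) (runitor_rinvunitor (htgt p)) (compatible_runitor p));
     lassociator := fun x y z w p q r => mk_cell (compatible_lassociator p q r);
     rassociator := fun x y z w p q r => mk_cell (compatible_inverse
       (p := comma_comp p (comma_comp q r)) (q := comma_comp (comma_comp p q) r)
       (lassociator_rassociator (hsrc p) (hsrc q) (hsrc r))
       (rassociator_lassociator (hsrc p) (hsrc q) (hsrc r))
       (lassociator_rassociator (htgt p) (htgt q) (htgt r))
       (compatible_lassociator p q r)) |}.

Lemma is_bicat_comma : is_bicat comma_data.
Proof.
  pose proof (bicat_laws A) as HA. pose proof (bicat_laws B) as HB.
  unfold is_bicat in HA, HB. decompose [and] HA. decompose [and] HB. clear HA HB.
  unfold is_bicat, comma_data; cbn [ob hom cell id1 comp1 id2 vcomp lwhisker rwhisker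
    lunitor linvunitor runitor rinvunitor lassociator rassociator].
  repeat match goal with |- _ /\ _ => split end; intros;
  apply comma_cell_eq; unfold csrc, ctgt, mk_cell; simpl; auto.
Qed.

Definition comma : Bicat := {| bicat_data_of := comma_data; bicat_laws := is_bicat_comma |}.

Definition comma_src_data : psfunctor_data comma A :=
  @Build_psfunctor_data comma A src (fun x y p => hsrc p) (fun x y p q c => csrc c)
    (fun x => id2 (id1 (src x))) (fun x y z p q => id2 (comp1 (hsrc p) (hsrc q))).

Definition comma_tgt_data : psfunctor_data comma B :=
  @Build_psfunctor_data comma B tgt (fun x y p => htgt p) (fun x y p q c => ctgt c)
    (fun x => id2 (id1 (tgt x))) (fun x y z p q => id2 (comp1 (htgt p) (htgt q))).

Lemma is_psfunctor_comma_src : is_psfunctor comma_src_data.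
Proof.
  repeat split; intros; unfold csrc; simpl;
  rewrite ?lwhisker_id2, ?id2_rwhisker, ?id2_left, ?id2_right; auto using invertible_id2.
Qed.

Lemma is_psfunctor_comma_tgt : is_psfunctor comma_tgt_data.
Proof.
  repeat split; intros; unfold ctgt; simpl;
  rewrite ?lwhisker_id2, ?id2_rwhisker, ?id2_left, ?id2_right; auto using invertible_id2.
Qed.

Definition comma_src : psfunctor comma A := Build_psfunctor comma A _ is_psfunctor_comma_src.
Definition comma_tgt : psfunctor comma B := Build_psfunctor comma B _ is_psfunctor_comma_tgt.

Lemma is_strict_comma_src : is_strict comma_src.
Proof. split; intros; exists eq_refl; reflexivity. Qed.

Lemma is_strict_comma_tgt : is_strict comma_tgt.
Proof. split; intros; exists eq_refl; reflexivity. Qed.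

(** Cancelling the equivalence [arr x] on the left recovers the target part from the source part: up
    to isomorphism for a 1-cell, uniquely for a 2-cell. *)
Lemma surjective_comma_src : is_surjective_equivalence comma_src.
Proof.
  split.
  { intros a. now exists (Build_comma_ob (equivalence_id (F a))). }
  intros x y. simpl. split; [| split].
  - intros f.
    destruct (lwhisker_equivalence_lift (comp1 (F1 F f) (arr y)) (arr_equivalence x))
      as (g & s & Hs).
    now exists (Build_comma_hom Hs).
  - intros p q al.
    destruct (lwhisker_equivalence_full
      (vcomp (inv (sq_invertible p)) (vcomp (rwhisker (arr y) (F2 F al)) (sq q)))
      (arr_equivalence x)) as [be Hbe].
    assert (H : compatible (p := p) (q := q) al be).
    { unfold compatible. now rewrite Hbe, <- vassoc, vcomp_inv, id2_left. }
    now exists (mk_cell H).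
  - intros p q c d H. apply comma_cell_eq; [exact H |].
    apply (lwhisker_equivalence_inj (arr_equivalence x)).
    apply (inv_cancel_left (sq_invertible p)).
    change (csrc c = csrc d) in H.
    pose proof (proj2_sig c) as Hc. pose proof (proj2_sig d) as Hd.
    unfold compatible in Hc, Hd.
    etransitivity; [symmetry; exact Hc |]. etransitivity; [| exact Hd].
    change (vcomp (rwhisker (arr y) (F2 F (csrc c))) (sq q)
      = vcomp (rwhisker (arr y) (F2 F (csrc d))) (sq q)).
    now rewrite H.
Qed.

(** Cancelling [arr y] on the right yields cells between images under [F], and the local equivalence
    brings these back to [A]. *)
Lemma surjective_comma_tgt : local_equivalence F ->
  (forall b, exists (a : A) (w : hom (F a) b), equivalence w) ->
  is_surjective_equivalence comma_tgt.
Proof.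
  intros HL He. split.
  { intros b. destruct (He b) as (a & w & Hw). now exists (Build_comma_ob Hw). }
  intros x y. simpl. destruct (HL (src x) (src y)) as (Hs & Hf & Hi). split; [| split].
  - intros g.
    destruct (rwhisker_equivalence_lift (comp1 (arr x) g) (arr_equivalence y)) as (k & s & I).
    destruct (Hs k) as (f & z & Hz).
    (* The square is the isomorphism [z] from [F1 F f] to [k], whiskered by [arr y], followed by
       [s]. *)
    now exists (Build_comma_hom (invertible_vcomp (invertible_rwhisker (arr y) Hz) I)).
  - intros p q be.
    destruct (rwhisker_equivalence_full
      (vcomp (sq p) (vcomp (lwhisker (arr x) be) (inv (sq_invertible q))))
      (arr_equivalence y)) as [k Hk].
    destruct (Hf _ _ k) as [al Hal].
    assert (H : compatible (p := p) (q := q) al be).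
    { unfold compatible. now rewrite Hal, Hk, !vassoc, inv_vcomp, id2_right. }
    now exists (mk_cell H).
  - intros p q c d H. apply comma_cell_eq; [| exact H].
    apply Hi, (rwhisker_equivalence_inj (arr_equivalence y)).
    apply (inv_cancel_right (sq_invertible q)).
    change (ctgt c = ctgt d) in H.
    etransitivity; [exact (proj2_sig c) |]. etransitivity; [| symmetry; exact (proj2_sig d)].
    change (vcomp (sq p) (lwhisker (arr x) (ctgt c)) = vcomp (sq p) (lwhisker (arr x) (ctgt d))).
    now rewrite H.
Qed.

End Comma.

(** * Biequivalences as spans of strict surjective equivalences *)

Unset Implicit Arguments.

Theorem theoremC (A B : Bicat) :
  biequivalent A B <->
  exists (C : Bicat) (P : psfunctor C A) (Q : psfunctor C B),
    is_strict P /\ is_strict Q /\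
    is_surjective_equivalence P /\ is_surjective_equivalence Q.
Proof.
  split.
  - rewrite biequivalentE. intros (F & G & HF & HG & H1 & H2).
    exists (comma HF), (comma_src HF), (comma_tgt HF).
    split; [apply is_strict_comma_src |]. split; [apply is_strict_comma_tgt |].
    split; [apply surjective_comma_src |]. apply surjective_comma_tgt.
    + exact (local_equivalence_of_inverse HG H1 H2).
    (* The component of the transformation to the identity at [b] is an equivalence from [F (G b)]
       to [b]. *)
    + intros b. destruct H2 as (t & _ & Et). exists (G b), (t b). apply Et.
  - intros (C & P & Q & _ & _ & HP & HQ). apply biequivalent_trans with C.
    + now apply biequivalent_sym, (biequivalent_of_surjective_equivalence (P := P)).
    + now apply (biequivalent_of_surjective_equivalence (P := Q)).
Qed.
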